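(* Let $k,n\in\mathbb{N}$. The $\chi_{n,k}^k$-spherical function $\varphi_{n,k}$ on $\mathfrak{S}_{kn}$ relative to the wreath product $\mathfrak{S}_k\wr\mathfrak{S}_n$ is expressed as a matrix element of the (unitary) representation $M_{n,k}^{T_{kn},\det}$ of $\mathfrak{S}_{kn}$ (which is isomorphic to the irreducible representation of $\mathfrak{S}_{kn}$ corresponding to the partition $(k^n)$): $$\varphi_{n,k}(g)=\frac{\langle g\cdot\operatorname{wrdet}_k(X),\,\operatorname{wrdet}_k(X)\rangle}{\langle\operatorname{wrdet}_k(X),\,\operatorname{wrdet}_k(X)\rangle}\qquad(g\in\mathfrak{S}_{kn}),$$ where $\langle\,,\,\rangle$ denotes the $\mathfrak{S}_{kn}$-invariant inner product on $M_{n,k}^{T_{kn},\det}$. In particular, $\varphi_{n,k}$ is a positive definite function on $\mathfrak{S}_{kn}$.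
   Context: $\mathfrak{S}_N$ is the symmetric group on $[N]=\{1,\dots,N\}$ and $\nu_N(w)$ is the number of cycles of $w\in\mathfrak{S}_N$ (fixed points included). For an $N\times N$ matrix $B=(b_{ij})$, $\det_k B:=\sum_{w\in\mathfrak{S}_N}(-\tfrac1k)^{N-\nu_N(w)}b_{w(1)1}\cdots b_{w(N)N}$. For a matrix $A$ with $n$ columns, $A^{[k]}$ is obtained by repeating each column $k$ times consecutively, and for a $kn\times n$ matrix $A$, $\operatorname{wrdet}_k A:=\det_k(A^{[k]})$. $X=(x_{ij})_{1\le i\le kn,1\le j\le n}$ is the matrix of coordinate functions on $\mathrm{Mat}_{kn,n}(\mathbb{C})$. The algebra $\mathcal{P}(\mathrm{Mat}_{kn,n})$ of polynomial functions on $\mathrm{Mat}_{kn,n}(\mathbb{C})$ is a $GL_{kn}\times GL_n$-module via $((g,h).f)(A)=f({}^tg\,A\,h)$. It decomposes without multiplicity as $\bigoplus_{\ell(\lambda)\le n}\mathcal{M}_{kn}^\lambda\boxtimes\mathcal{M}_n^\lambda$, where $\mathcal{M}_m^\lambda$ is the irreducible polynomial $GL_m$-module of highest weight $\lambda$. $M_{n,k}$ is the irreducible submodule isomorphic to $\mathcal{M}_{kn}^{(k^n)}\boxtimes\mathcal{M}_n^{(k^n)}$, with $(k^n)$ the partition with $n$ parts equal to $k$. $T_{kn}$ is the diagonal torus of $GL_{kn}$ and $M_{n,k}^{T_{kn},\det}=\{v\in M_{n,k}: t.v=\det(t)v\ \ (t\in T_{kn})\}$, an $\mathfrak{S}_{kn}$-module,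 where $\mathfrak{S}_{kn}\subset GL_{kn}$ as permutation matrices $(\delta_{i\sigma(j)})_{i,j}$, so that $(g\cdot f)(A)=f(g^{-1}\cdot A)$ with $\sigma\cdot A=(a_{\sigma^{-1}(i)j})_{i,j}$. It contains $\operatorname{wrdet}_k(X)$. $S_k^n\subset\mathfrak{S}_{kn}$ is the subgroup ($\cong\mathfrak{S}_k^n$) of permutations preserving each block $\{(i-1)k+1,\dots,ik\}$, $1\le i\le n$; $S_n=\psi(\mathfrak{S}_n)$ with $\psi(\tau):(i-1)k+j\mapsto(\tau(i)-1)k+j$; $\mathfrak{S}_k\wr\mathfrak{S}_n=S_k^n\rtimes S_n$; and $\chi_{n,k}(\sigma\psi(\tau))=\operatorname{sgn}\tau$ for $\sigma\in S_k^n$, $\tau\in\mathfrak{S}_n$. Let $\mathbf{1}_k$ be the $k\times k$ all-one matrix and $\mathbf{1}_k^{\oplus n}$ the block diagonal matrix with $n$ blocks $\mathbf{1}_k$. For $g\in\mathfrak{S}_{kn}$, $$\varphi_{n,k}(g)=\frac{\det_k(g\cdot\mathbf{1}_k^{\oplus n})}{\det_k(\mathbf{1}_k^{\oplus n})}=\frac{k^{kn}}{|S_k^n|}\sum_{\sigma\in S_k^n}\Bigl(-\frac1k\Bigr)^{kn-\nu_{kn}(g^{-1}\sigma)}.$$ It is called $\chi_{n,k}^k$-spherical because $\varphi_{n,k}(h_1gh_2)=\chi_{n,k}(h_1h_2)^k\varphi_{n,k}(g)$ for $h_1,h_2\in\mathfrak{S}_k\wr\mathfrak{S}_n$. A function $\varphi$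 on a finite group $G$ is positive definite if $\sum_{g,h\in G}c_g\overline{c_h}\,\varphi(h^{-1}g)\ge0$ for all complex numbers $c_g$. *)

(* Defs.v *)
From HB Require Import structures.
From mathcomp Require Import all_boot all_order all_algebra all_fingroup.
From mathcomp Require Import reals.
From mathcomp Require Export complex mpoly.

Set Implicit Arguments.
Unset Strict Implicit.
Unset Printing Implicit Defensive.

Import Order.TTheory GRing.Theory Num.Theory.
Local Open Scope ring_scope.

(* Linear actions on submodules.  A submodule is a Prop-valued predicate on an
   ambient (possibly infinite-dimensional) vector space; [D] cuts the acting
   group out of the type [G]. *)

Section Modules.
Variables (C : fieldType) (G : Type) (D : G -> Prop).

Definition is_submodule (U : lmodType C) (act : G -> U -> U) (P : U -> Prop) :=
  [/\ P 0,
      forall (a : C) u v, P u -> P v -> P (a *: u + v) &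
      forall g u, D g -> P u -> P (act g u)].

Definition is_irreducible (U : lmodType C) (act : G -> U -> U) (P : U -> Prop) :=
  [/\ is_submodule act P,
      exists2 u, P u & u != 0 &
      forall W : U -> Prop, is_submodule act W -> (forall u, W u -> P u) ->
        (forall u, W u -> u = 0) \/ (forall u, P u -> W u)].

(* The isomorphism is the restriction to [P] of a linear map defined on the
   whole ambient space; over a field every linear map on [P] extends so. *)
Definition isomorphic (U V : lmodType C) (actU : G -> U -> U) (P : U -> Prop)
    (actV : G -> V -> V) (Q : V -> Prop) :=
  exists Phi : {linear U -> V},
    [/\ forall u, P u -> Phi u = 0 -> u = 0,
        forall v, Q v <-> exists2 u, P u & v = Phi u &
        forall g u, D g -> P u -> Phi (actU g u) = actV g (Phi u)].

End Modules.

Definition invariant_inner_product (C : numClosedFieldType) (G : Type)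
    (U : lmodType C) (act : G -> U -> U) (P : U -> Prop) (ip : U -> U -> C) :=
  [/\ forall (a : C) u v w, P u -> P v -> P w ->
        ip (a *: u + v) w = a * ip u w + ip v w,
      forall u v, P u -> P v -> ip v u = (ip u v)^*,
      forall u, P u -> u != 0 -> 0 < ip u u &
      forall g u v, P u -> P v -> ip (act g u) (act g v) = ip u v].

(* Permutations.  In MathComp [(s * t) x = t (s x)]; the composition of maps
   s o t, which is the product of the symmetric group here, is [(t * s)%g]. *)

Definition permo N (s t : 'S_N) : 'S_N := (t * s)%g.

(* [delta_(i, s j)], the transpose of MathComp's [perm_mx s] *)
Definition permutation_matrix (C : nzRingType) N (s : 'S_N) : 'M[C]_N :=
  \matrix_(i, j) (i == s j)%:R.

Definition row_act (T : Type) N n (s : 'S_N) (A : 'M[T]_(N, n)) : 'M[T]_(N, n) :=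
  \matrix_(i, j) A ((s^-1)%g i) j.

(* the alpha-determinant at alpha = -1/k *)
Definition detk (R : comUnitRingType) (k N : nat) (B : 'M[R]_N) : R :=
  \sum_(w : 'S_N) (- k%:R^-1) ^+ (N - #|porbits w|) * \prod_j B (w j) j.

Lemma block_of_subproof k n (i : 'I_(k * n)) : (i %/ k < n)%N.
Proof.
by case: k i => [[//]|k] i; rewrite ltn_divLR // [X in (_ < X)%N]mulnC; exact: ltn_ord.
Qed.

(* the 0-based index of the block of [k] consecutive indices containing [i] *)
Definition block_of k n (i : 'I_(k * n)) : 'I_n := Ordinal (block_of_subproof i).

Definition col_repeat (T : Type) (k m n : nat) (A : 'M[T]_(m, n)) :
    'M[T]_(m, k * n) :=
  \matrix_(i, j) A i (block_of j).

Definition wrdet (R : comUnitRingType) (k n : nat) (A : 'M[R]_(k * n, n)) : R :=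
  detk k (col_repeat k A).

Definition block_ones (R : nzRingType) (k n : nat) : 'M[R]_(k * n) :=
  \matrix_(i, j) (block_of i == block_of j)%:R.

Definition phi (C : fieldType) (k n : nat) (g : 'S_(k * n)) : C :=
  detk k (row_act g (block_ones C k n)) / detk k (block_ones C k n).

Definition positive_definite (C : numClosedFieldType) N (f : 'S_N -> C) :=
  forall c : 'S_N -> C,
    0 <= \sum_(g : 'S_N) \sum_(h : 'S_N)
           c g * (c h)^* * f (permo (h^-1)%g g).

(* Polynomial functions on m x n matrices are polynomials in m * n variables,
   the coordinate x_(i, j) being the variable of index [mxvec_index i j]. *)

Section PolynomialFunctions.
Variable C : fieldType.

Definition Xmx m n : 'M[{mpoly C[m * n]}]_(m, n) := vec_mx (\row_i 'X_i).

Definition eval_mx m n (f : {mpoly C[m * n]}) (A : 'M[C]_(m, n)) : C :=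
  f.@[fun i => mxvec A 0 i].

Definition GLxGL m n (gh : 'M[C]_m * 'M[C]_n) : Prop :=
  gh.1 \in unitmx /\ gh.2 \in unitmx.

(* ((g, h).f)(A) = f(g^T A h), as a substitution in the polynomial f *)
Definition gl_act m n (gh : 'M[C]_m * 'M[C]_n) (f : {mpoly C[m * n]}) :
    {mpoly C[m * n]} :=
  f \mPo [tuple mxvec (map_mx (@mpolyC (m * n) C) gh.1^T *m Xmx m n
                         *m map_mx (@mpolyC (m * n) C) gh.2) 0 i | i < m * n].

Definition sym_act m n (s : 'S_m) (f : {mpoly C[m * n]}) : {mpoly C[m * n]} :=
  gl_act (permutation_matrix C s, 1%:M) f.

(* [rho] is the irreducible polynomial representation of GL_m on C^d with
   highest weight [la], with respect to the upper triangular Borel subgroup;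
   the values of [rho] outside GL_m are irrelevant. *)
Definition irr_poly_rep m d (la : seq nat) (rho : 'M[C]_m -> 'M[C]_d) :=
  [/\ forall i j, exists p : {mpoly C[m * m]},
        forall g, g \in unitmx -> rho g i j = eval_mx p g,
      rho 1%:M = 1%:M,
      {in unitmx &, forall g h, rho (g *m h) = rho g *m rho h},
      is_irreducible (fun g => g \in unitmx)
        (fun g (v : 'cV[C]_d) => rho g *m v) (fun=> True) &
      exists2 v : 'cV[C]_d, v != 0 &
        forall b, b \in unitmx -> is_trig_mx b^T ->
          rho b *m v = (\prod_i b i i ^+ nth 0%N la i) *: v].

(* [M] is isomorphic to the outer tensor product of the irreducible modules of
   highest weight [la] of GL_m and GL_n; C^d1 (x) C^d2 is realised as the space
   of d1 x d2 matrices, u (x) v being u *m v^T. *)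
Definition is_irr_component m n (la : seq nat) (M : {mpoly C[m * n]} -> Prop) :=
  exists d1 d2 (rho1 : 'M[C]_m -> 'M[C]_d1) (rho2 : 'M[C]_n -> 'M[C]_d2),
    [/\ irr_poly_rep la rho1, irr_poly_rep la rho2 &
        isomorphic (@GLxGL m n)
          (fun gh (Y : 'M[C]_(d1, d2)) => rho1 gh.1 *m Y *m (rho2 gh.2)^T)
          (fun=> True)
          (@gl_act m n) M].

Definition torus_det m n (M : {mpoly C[m * n]} -> Prop) (f : {mpoly C[m * n]}) :=
  M f /\ forall t : 'rV[C]_m, diag_mx t \in unitmx ->
    gl_act (diag_mx t, 1%:M) f = \det (diag_mx t) *: f.

End PolynomialFunctions.

(* The Specht module of a partition [la] of N, as the left ideal generated by
   the Young symmetrizer in the group algebra; [x : 'I_N] sits in row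
   [reshape_index la x] and column [reshape_offset la x] of the tableau filled
   row by row. *)

Section Specht.
Variables (C : fieldType) (N : nat).

Definition grp_alg := {ffun 'S_N -> C^o}.

Definition conv (y z : grp_alg) : grp_alg :=
  [ffun s => \sum_(t : 'S_N) y t * z (permo (t^-1)%g s)].

Definition left_transl (g : 'S_N) (z : grp_alg) : grp_alg :=
  [ffun s => z (permo (g^-1)%g s)].

Definition row_stab (la : seq nat) : {set 'S_N} :=
  [set p : 'S_N | [forall x, reshape_index la (p x) == reshape_index la x]].

Definition col_stab (la : seq nat) : {set 'S_N} :=
  [set q : 'S_N | [forall x, reshape_offset la (q x) == reshape_offset la x]].

Definition young_symmetrizer (la : seq nat) : grp_alg :=
  [ffun s => \sum_(p in row_stab la) \sum_(q in col_stab la | s == permo p q)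
               (-1) ^+ odd_perm q].

Definition specht (la : seq nat) (z : grp_alg) : Prop :=
  exists y, z = conv y (young_symmetrizer la).

End Specht.

(* Main.v *)
Require Import Defs.
From HB Require Import structures.
From mathcomp Require Import all_boot all_order all_algebra all_fingroup.
From mathcomp Require Import boolp reals.
From mathcomp Require Import complex mpoly.
Set Implicit Arguments.
Unset Strict Implicit.
Unset Printing Implicit Defensive.
Import Order.TTheory GRing.Theory Num.Theory.
Local Open Scope ring_scope.

(** Write N = kn and place the indices below N in an n x k rectangle, the i-th
    row holding the i-th block of k consecutive ones; Row and Col are its row
    and column groups.  Let m0 be the product of the x_(i,j) with i in block j,
    e the alternating sum of the translates of m0 under Col, and w' the sum of
    the translates of e under Row.  Everything takes place in the span S of the
    translates of e, and rests on two identifications.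

    The first is V = S.  The highest weight (k^n) for GL_n is the k-th power of
    the determinant: a transposition lies in the closure of a one-parameter
    family which shows that it acts on the highest weight vector like its
    determinant to the k ([det_stable_tperm]), so the GL_n factor is a line
    ([det_power_rep_line]).  A highest weight vector of the component M is then
    forced to be a multiple of the k-th power of the minor on the first n rows
    ([semi_invariant_minor_power]), and M is generated by it.  The GL-translates
    of this power are the functions det(GX)^k; expanding them along the
    rectangle, the part of degree one in each row of X is a combination of
    translates of e ([multilinear_part_minor_power]), and it is w' when G sums
    the rows of each block.

    The second is that the wreath determinant is a positive multiple of w'
    ([alpha_sum_spherical]).  Up to a constant, (-1/k)^(N - #cycles) is the sign
    of the permutation times the number of colourings of the indices with k
    colours that it fixes.  Exchanging the sums, a colouring which repeats a
    colour in a block contributes 0, and the others are the translates of the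
    colouring by columns under Row.

    The representation theory of S follows from von Neumann's lemma: a function
    on the symmetric group which is invariant under Row on the left and
    alternating under Col on the right is a multiple of the Young symmetrizer
    ([young_symmetrizer_unique]).  Hence the Row-invariants of S are the
    multiples of w', every nonzero submodule contains w', and S is isomorphic to
    the Specht module.  For any invariant inner product, averaging g w' over Row
    gives <g w', w'> / <w', w'> = (g w')(E) / w'(E), where E is the matrix with
    entry 1 at (i, j) when i is in block j and 0 elsewhere.  The right-hand side
    is the spherical function at the inverse of g, and the spherical function is
    real, so that the inverse is harmless.  Positive definiteness is that of
    the matrix element. *)

(** * Young symmetrizers of rectangles *)

Lemma permoE N (s t : 'S_N) x : permo s t x = s (t x).
Proof. by rewrite /permo permM. Qed.

Lemma permoA N (s t u : 'S_N) : permo s (permo t u) = permo (permo s t) u.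
Proof. by rewrite /permo mulgA. Qed.

Lemma permoKV N (s t : 'S_N) : permo s (permo s^-1 t) = t.
Proof. by rewrite /permo mulgKV. Qed.

Lemma permoK N (s t : 'S_N) : permo s^-1 (permo s t) = t.
Proof. by rewrite /permo mulgK. Qed.

Lemma permo1 N (s : 'S_N) : permo s 1 = s.
Proof. exact: mul1g. Qed.

Lemma perm1o N (s : 'S_N) : permo 1 s = s.
Proof. exact: mulg1. Qed.

Lemma permoV N (s t : 'S_N) : (permo s t)^-1%g = permo t^-1 s^-1.
Proof. exact: invMg. Qed.

Lemma permo_inj N (s : 'S_N) : injective (permo s).
Proof. exact: mulIg. Qed.

Lemma permo_injl N (s : 'S_N) : injective (fun t : 'S_N => permo t s).
Proof. exact: mulgI. Qed.

Section Rectangle.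
Variables (k n : nat) (hk : (0 < k)%N).
Local Notation N := (k * n)%N.
Local Notation la := (nseq n k).
Local Notation blk := (@block_of k n).

Definition offset_of (x : 'I_N) : 'I_k := Ordinal (ltn_pmod x hk).

Lemma cell_subproof (i : 'I_n) (r : 'I_k) : (i * k + r < k * n)%N.
Proof.
have lt_r := ltn_ord r; have lt_i := ltn_ord i.
apply: (@leq_trans (i.+1 * k)); first by rewrite mulSn addnC ltn_add2r.
by rewrite mulnC leq_mul2l lt_i orbT.
Qed.

Definition cell (i : 'I_n) (r : 'I_k) : 'I_N := Ordinal (cell_subproof i r).

Lemma block_of_cell i r : blk (cell i r) = i.
Proof. by apply/val_inj; rewrite /= divnMDl // divn_small ?addn0. Qed.

Lemma offset_of_cell i r : offset_of (cell i r) = r.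
Proof. by apply/val_inj; rewrite /= modnMDl modn_small. Qed.

Lemma cellK x : cell (blk x) (offset_of x) = x.
Proof. by apply/val_inj; rewrite /= -divn_eq. Qed.

Lemma cell_inj x y : blk x = blk y -> offset_of x = offset_of y -> x = y.
Proof. by move=> eb eo; rewrite -[x]cellK eb eo cellK. Qed.

Lemma flatten_index_rectangle (x : 'I_N) : flatten_index la (x %/ k) (x %% k) = x.
Proof.
have lt_xn := ltn_ord (blk x); rewrite /= in lt_xn.
by rewrite /flatten_index take_nseq ?(ltnW lt_xn) // sumn_nseq mulnC -divn_eq.
Qed.

Lemma reshape_index_rectangle (x : 'I_N) : reshape_index la x = blk x.
Proof.
rewrite -{1}(flatten_index_rectangle x) flatten_indexKl //.
by rewrite nth_nseq (ltn_ord (blk x)) ltn_pmod.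
Qed.

Lemma reshape_offset_rectangle (x : 'I_N) : reshape_offset la x = offset_of x.
Proof.
rewrite -{1}(flatten_index_rectangle x) flatten_indexKr //.
by rewrite nth_nseq (ltn_ord (blk x)) ltn_pmod.
Qed.

Local Notation Row := (row_stab N la).
Local Notation Col := (col_stab N la).

Lemma row_stabP (p : 'S_N) : reflect (forall x, blk (p x) = blk x) (p \in Row).
Proof.
rewrite inE; apply: (iffP forallP) => Hp x.
  by apply/val_inj; have := eqP (Hp x); rewrite !reshape_index_rectangle.
by rewrite !reshape_index_rectangle Hp.
Qed.

Lemma col_stabP (q : 'S_N) :
  reflect (forall x, offset_of (q x) = offset_of x) (q \in Col).
Proof.
rewrite inE; apply: (iffP forallP) => Hq x.
  by apply/val_inj; have := eqP (Hq x); rewrite !reshape_offset_rectangle.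
by rewrite !reshape_offset_rectangle Hq.
Qed.

Lemma row_stab1 : 1%g \in Row.
Proof. by apply/row_stabP => x; rewrite perm1. Qed.

Lemma col_stab1 : 1%g \in Col.
Proof. by apply/col_stabP => x; rewrite perm1. Qed.

Lemma row_stabV p : (p^-1%g \in Row) = (p \in Row).
Proof.
have V q : q \in Row -> q^-1%g \in Row.
  by move/row_stabP=> Hq; apply/row_stabP=> x; rewrite -{2}[x](permKV q) Hq.
by apply/idP/idP => /V //; rewrite invgK.
Qed.

Lemma col_stabV p : (p^-1%g \in Col) = (p \in Col).
Proof.
have V q : q \in Col -> q^-1%g \in Col.
  by move/col_stabP=> Hq; apply/col_stabP=> x; rewrite -{2}[x](permKV q) Hq.
by apply/idP/idP => /V //; rewrite invgK.
Qed.

Lemma row_stab_permol p s : p \in Row -> (permo p s \in Row) = (s \in Row).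
Proof.
move/row_stabP=> Hp; apply/row_stabP/row_stabP => Hs x;
  by have := Hs x; rewrite permoE Hp.
Qed.

Lemma row_stab_permor s p : p \in Row -> (permo s p \in Row) = (s \in Row).
Proof.
by move=> Hp; rewrite -row_stabV permoV row_stab_permol ?row_stabV.
Qed.

Lemma col_stab_permol p s : p \in Col -> (permo p s \in Col) = (s \in Col).
Proof.
move/col_stabP=> Hp; apply/col_stabP/col_stabP => Hs x;
  by have := Hs x; rewrite permoE Hp.
Qed.

Lemma col_stab_permor s p : p \in Col -> (permo s p \in Col) = (s \in Col).
Proof.
by move=> Hp; rewrite -col_stabV permoV col_stab_permol ?col_stabV.
Qed.

Lemma row_col_stab1 s : s \in Row -> s \in Col -> s = 1%g.
Proof.
move=> /row_stabP Hr /col_stabP Hc; apply/permP => x.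
by rewrite perm1; apply: cell_inj.
Qed.

Lemma row_col_factor_inj p q p' q' :
  p \in Row -> q \in Col -> p' \in Row -> q' \in Col ->
  permo p q = permo p' q' -> p = p' /\ q = q'.
Proof.
move=> Rp Cq Rp' Cq' eqpq.
have eq1 : permo p'^-1 p = permo q' q^-1.
  apply: (@permo_injl _ q); rewrite /= -permoA eqpq permoK.
  by rewrite -permoA /permo mulgV mul1g.
have : permo p'^-1 p = 1%g.
  apply: row_col_stab1; first by rewrite row_stab_permol ?row_stabV.
  by rewrite eq1 col_stab_permol // col_stabV.
move=> eqp; have -> : p = p' by rewrite -[p](permoKV p') eqp permo1.
split=> //; rewrite eqp in eq1.
by have /(congr1 (fun t => permo t q)) := eq1; rewrite perm1o -permoA /permo mulgV mul1g.
Qed.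

(** A rectangle leaves only two possibilities: either [s] sends two cells of a
    column to the same row, or each column meets each row exactly once and the
    column permutation is read off from the rows hit by [s]. *)
Lemma row_col_dichotomy (s : 'S_N) :
  (exists p q, [/\ p \in Row, q \in Col & s = permo p q]) \/
  (exists x y, [/\ x != y, offset_of x = offset_of y & blk (s x) = blk (s y)]).
Proof.
pose f x := cell (blk (s x)) (offset_of x).
case: (boolP (injectiveb f)) => [/injectiveP injf | /injectivePn [x [y nxy efxy]]];
  [left | right]; last first.
  exists x, y; split=> //.
    by have := congr1 offset_of efxy; rewrite !offset_of_cell.
  by have := congr1 blk efxy; rewrite !block_of_cell.
pose q := perm injf.
have qE x : q x = f x by rewrite permE.
exists (permo s q^-1), q; split.
- apply/row_stabP => x; rewrite permoE -{2}[x](permKV q) qE.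
  by rewrite block_of_cell.
- by apply/col_stabP => x; rewrite qE offset_of_cell.
- by rewrite -permoA /permo mulgV mul1g.
Qed.

Section Symmetrizer.
Variable C : numFieldType.
Local Notation y := (young_symmetrizer C N la).

Lemma young_symmetrizer_permo p q :
  p \in Row -> q \in Col -> y (permo p q) = (-1) ^+ odd_perm q.
Proof.
move=> Rp Cq; rewrite ffunE (bigD1 p) //= (bigD1 q) /=; last by rewrite Cq eqxx.
rewrite big1 ?addr0 => [|q' /andP[/andP[Cq' /eqP eq] nq]]; last first.
  by have [_ eqq] := row_col_factor_inj Rp Cq Rp Cq' eq; rewrite eqq eqxx in nq.
rewrite big1 ?addr0 // => p' /andP[Rp' np]; rewrite big1 // => q' /andP[Cq' /eqP eq].
by have [eqp _] := row_col_factor_inj Rp Cq Rp' Cq' eq; rewrite eqp eqxx in np.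
Qed.

(** Von Neumann's lemma.  If [s] is not in Row * Col, a transposition [t] of
    two cells of a column becomes a row transposition after conjugation by
    [s], so [H s] = [H (s t)] = - [H s]. *)
Lemma young_symmetrizer_unique (U : lmodType C) (H : 'S_N -> U) :
  (forall p s, p \in Row -> H (permo p s) = H s) ->
  (forall s q, q \in Col -> H (permo s q) = (-1) ^+ odd_perm q *: H s) ->
  forall s, H s = y s *: H 1%g.
Proof.
move=> Hrow Hcol s.
case: (row_col_dichotomy s) => [[p [q [Rp Cq ->]]] | [x [z [nxz oxz bxz]]]].
  rewrite young_symmetrizer_permo // Hrow // -[q in LHS]perm1o Hcol //.
pose t := tperm x z.
have Ct : t \in Col.
  by apply/col_stabP => u; rewrite /t; case: tpermP => [->|->|].
have Rst : permo (permo s t) s^-1 \in Row.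
  apply/row_stabP => u; rewrite !permoE -{2}[u](permKV s).
  by rewrite /t; case: tpermP => [->|->|].
have H0 : H s = 0.
  have := Hcol s t Ct; rewrite odd_tperm nxz expr1 scaleN1r.
  have -> : permo s t = permo (permo (permo s t) s^-1) s.
    by rewrite -permoA /permo mulgV mul1g.
  rewrite Hrow // => /eqP; rewrite eq_sym -subr_eq0 -opprD oppr_eq0.
  by rewrite -mulr2n -scaler_nat scaler_eq0 pnatr_eq0 => /eqP.
rewrite H0 ffunE big1 ?scale0r // => p Rp; rewrite big1 // => q /andP[Cq /eqP espq].
case/eqP: nxz; apply: cell_inj => //.
have /row_stabP Hp := Rp; have /col_stabP Hq := Cq.
have eqq : q x = q z.
  apply: cell_inj; last by rewrite !Hq.
  by rewrite -Hp -[RHS]Hp -!permoE -espq.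
by rewrite (perm_inj eqq).
Qed.

End Symmetrizer.
End Rectangle.

(** * Colourings fixed by a permutation *)

Lemma card_fixed_colorings (T : finType) (k : nat) (w : {perm T}) : (0 < k)%N ->
  #|[set c : {ffun T -> 'I_k} | [forall x, c (w x) == c x]]| = (k ^ #|porbits w|)%N.
Proof.
move=> hk; pose r0 : 'I_k := Ordinal hk.
pose D := pffun_on r0 [in porbits w] predT.
have <- : #|D| = (k ^ #|porbits w|)%N by rewrite card_pffun_on card_ord.
pose h (g : {ffun {set T} -> 'I_k}) := [ffun x => g (porbit w x)].
have injh : {in D &, injective h}.
  move=> g g' /pffun_onP[/supportP Dg _] /pffun_onP[/supportP Dg' _] eqh.
  apply/ffunP => A; case: (boolP (A \in porbits w)) => [/imsetP[x _ ->]|nA].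
    by have /ffunP/(_ x) := eqh; rewrite !ffunE.
  by rewrite Dg // Dg'.
rewrite -(card_in_imset injh); apply: eq_card => c; rewrite inE.
apply/forallP/imsetP => [Hc|[g _ ->] x]; last first.
  rewrite !ffunE; apply/eqP; congr (g _); apply/eqP.
  by rewrite eq_porbit_mem; have := mem_porbit w 1 x; rewrite expg1.
have cst x z : z \in porbit w x -> c z = c x.
  move=> /porbitP[i ->]; elim: i => [|i IH]; first by rewrite expg0 perm1.
  by rewrite expgSr permM (eqP (Hc _)).
exists [ffun A : {set T} => if A \in porbits w then
         oapp c r0 [pick x in A] else r0].
  apply/pffun_onP; split=> //; apply/supportP => A /negbTE nA.
  by rewrite ffunE nA.
apply/ffunP => x; rewrite !ffunE imset_f //.
by case: pickP => [z /cst /= -> //|/(_ x)]; rewrite porbit_id.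
Qed.

(** A colouring is fixed when it is constant on the cycles, so the fixed ones
    number k to the number of cycles; the rest of the weight is the sign. *)
Lemma alpha_weight (F : fieldType) (k N : nat) (w : 'S_N) :
  k%:R != 0 :> F ->
  (- k%:R^-1) ^+ (N - #|porbits w|)
  = k%:R ^- N * (-1) ^+ odd_perm w
    * #|[set c : {ffun 'I_N -> 'I_k} | [forall x, c (w x) == c x]]|%:R :> F.
Proof.
move=> nk; have hk : (0 < k)%N by case: k nk => //; rewrite eqxx.
have le_wN : (#|porbits w| <= N)%N.
  by have := leq_imset_card (porbit w) predT; rewrite card_ord.
rewrite card_fixed_colorings // [LHS]exprNn [LHS]mulrC natrX mulrAC; congr (_ * _).
  rewrite exprVn; set c := #|porbits w| in le_wN *.
  have -> : k%:R ^- N = k%:R ^- (N - c) * k%:R ^- c :> F.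
    by rewrite -invfM -exprD subnK.
  by rewrite divfK // expf_neq0.
by rewrite -signr_odd oddB // /odd_perm card_ord.
Qed.

(** * The module generated by a polytabloid *)

Section Submodule.
Variables (F : fieldType) (G : Type) (D : G -> Prop) (V : lmodType F).
Variables (act : G -> V -> V) (P : V -> Prop).
Hypothesis subP : is_submodule D act P.

Lemma submoduleZ a u : P u -> P (a *: u).
Proof.
by case: subP => P0 Plin _ Pu; rewrite -[_ *: _]addr0; apply: Plin.
Qed.

Lemma submodule_sum (I : Type) (r : seq I) (Q : pred I) (f : I -> V) :
  (forall i, Q i -> P (f i)) -> P (\sum_(i <- r | Q i) f i).
Proof.
case: subP => P0 Plin _ Pf; elim/big_rec: _ => // i x Qi Px.
by rewrite -[f i]scale1r; apply: Plin => //; apply: Pf.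
Qed.

Lemma submodule_act g u : D g -> P u -> P (act g u).
Proof. by case: subP => _ _; apply. Qed.

End Submodule.

Section InnerProduct.
Variables (C : numClosedFieldType) (G : Type) (U : lmodType C) (act : G -> U -> U).
Variables (P : U -> Prop) (ip : U -> U -> C).
Hypothesis subP : is_submodule (fun=> True) act P.
Hypothesis ipP : invariant_inner_product act P ip.

Lemma inner_productC u v : P u -> P v -> ip v u = (ip u v)^*.
Proof. by case: ipP => _ ipC _ _; apply: ipC. Qed.

Lemma inner_product_act g u v : P u -> P v -> ip (act g u) (act g v) = ip u v.
Proof. by case: ipP => _ _ _ ip_act; apply: ip_act. Qed.

Lemma inner_product_gt0 u : P u -> u != 0 -> 0 < ip u u.
Proof. by case: ipP => _ _ ip_gt0 _; apply: ip_gt0. Qed.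

Lemma inner_product0 v : P v -> ip 0 v = 0.
Proof.
case: ipP => ip_lin _ _ _ Pv; have := ip_lin (-1) _ _ _ Pv Pv Pv.
by rewrite scaleN1r addNr mulN1r addNr.
Qed.

Lemma inner_productZ a u v : P u -> P v -> ip (a *: u) v = a * ip u v.
Proof.
case: (ipP) (subP) => ip_lin _ _ _ [P0 _ _] Pu Pv.
by have := ip_lin a _ _ _ Pu P0 Pv; rewrite inner_product0 // !addr0.
Qed.

Lemma inner_productZZ a u v : P u -> P v -> ip (a *: u) (a *: v) = a * a^* * ip u v.
Proof.
move=> Pu Pv; have PZ := submoduleZ subP a Pv.
rewrite inner_productZ // -mulrA; congr (_ * _).
by rewrite inner_productC // inner_productZ // rmorphM /= -inner_productC.
Qed.

Lemma inner_product_sum (I : finType) (Q : pred I) (f : I -> U) v :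
  (forall i, P (f i)) -> P v ->
  ip (\sum_(i | Q i) f i) v = \sum_(i | Q i) ip (f i) v.
Proof.
move=> Pf Pv; case: (ipP) => ip_lin _ _ _.
suff [] : P (\sum_(i | Q i) f i) /\
  ip (\sum_(i | Q i) f i) v = \sum_(i | Q i) ip (f i) v by [].
elim/big_rec2: _ => [|i b u Qi [Pu <-]].
  by split; [case: subP | apply: inner_product0].
have [_ Plin _] := subP; split; first by rewrite -[f i]scale1r; apply: Plin.
by rewrite -{1}[f i]scale1r ip_lin // mul1r.
Qed.

End InnerProduct.

Section Tabloid.
Variables (C : numClosedFieldType) (k n : nat) (hk : (0 < k)%N).
Local Notation N := (k * n)%N.
Local Notation la := (nseq n k).
Local Notation Row := (row_stab N la).
Local Notation Col := (col_stab N la).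
Local Notation y := (young_symmetrizer C N la).
Local Notation sgn q := ((-1) ^+ odd_perm q : C).

Variables (U : lmodType C) (act : 'S_N -> {linear U -> U}).
Hypothesis act1 : forall u, act 1%g u = u.
Hypothesis actM : forall s t u, act (permo s t) u = act s (act t u).

Lemma act_invK s u : act s^-1 (act s u) = u.
Proof. by rewrite -actM /permo mulgV act1. Qed.

Lemma act_invKV s u : act s (act s^-1 u) = u.
Proof. by rewrite -actM /permo mulVg act1. Qed.

Definition group_span (v u : U) := exists z : 'S_N -> C, u = \sum_s z s *: act s v.

Definition row_sum u := \sum_(p in Row) act p u.
Definition col_alt u := \sum_(q in Col) sgn q *: act q u.

Lemma row_sum_linear : linear row_sum.
Proof.
move=> a u v; rewrite scaler_sumr -big_split; apply: eq_bigr => p _.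
exact: linearP.
Qed.
HB.instance Definition _ :=
  GRing.isLinear.Build C U U *:%R row_sum row_sum_linear.

Lemma col_alt_linear : linear col_alt.
Proof.
move=> a u v; rewrite scaler_sumr -big_split; apply: eq_bigr => q _ /=.
by rewrite linearP scalerDr !scalerA mulrC.
Qed.
HB.instance Definition _ :=
  GRing.isLinear.Build C U U *:%R col_alt col_alt_linear.

Lemma row_sumE p u : p \in Row -> row_sum (act p u) = row_sum u.
Proof.
move=> Rp; rewrite /row_sum [RHS](reindex_inj (@permo_injl _ p)) /=.
by apply: eq_big => [s|s _]; rewrite ?actM // row_stab_permor.
Qed.

Lemma act_row_sum p u : p \in Row -> act p (row_sum u) = row_sum u.
Proof.
move=> Rp; rewrite linear_sum /row_sum [RHS](reindex_inj (@permo_inj _ p)) /=.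
by apply: eq_big => [s|s _]; rewrite ?actM // row_stab_permol.
Qed.

Lemma col_altE q u : q \in Col -> col_alt (act q u) = sgn q *: col_alt u.
Proof.
move=> Cq; rewrite /col_alt scaler_sumr [RHS](reindex_inj (@permo_injl _ q)) /=.
apply: eq_big => [s|s _]; first by rewrite col_stab_permor.
rewrite actM scalerA /permo odd_permM signr_addb mulrA.
by rewrite -signr_addb addbb mul1r.
Qed.

Lemma act_col_alt q u : q \in Col -> act q (col_alt u) = sgn q *: col_alt u.
Proof.
move=> Cq; rewrite linear_sum /col_alt scaler_sumr.
rewrite [RHS](reindex_inj (@permo_inj _ q)) /=.
apply: eq_big => [s|s _]; first by rewrite col_stab_permol.
rewrite linearZ /= actM scalerA /permo odd_permM signr_addb.
by rewrite [X in _ * X]mulrC mulrA -signr_addb addbb mul1r.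
Qed.

Lemma card_row_gt0 : 0 < #|Row|%:R :> C.
Proof. by rewrite ltr0n; apply/card_gt0P; exists 1%g; apply: row_stab1. Qed.

Lemma group_span_submodule v : is_submodule (fun=> True) act (group_span v).
Proof.
split=> [|a u1 u2 [z1 ->] [z2 ->]|g u _ [z ->]].
- by exists (fun=> 0); rewrite big1 // => s _; rewrite scale0r.
- exists (fun s => a * z1 s + z2 s); rewrite scaler_sumr -big_split /=.
  by apply: eq_bigr => s _; rewrite scalerDl scalerA.
- exists (fun s => z (permo g^-1 s)); rewrite linear_sum.
  rewrite [RHS](reindex_inj (@permo_inj _ g)) /=; apply: eq_bigr => s _.
  by rewrite linearZ /= permoK actM.
Qed.

Lemma group_span_min (P : U -> Prop) v : is_submodule (fun=> True) act P -> P v ->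
  forall u, group_span v u -> P u.
Proof.
move=> subP Pv u [z ->]; apply: (submodule_sum subP) => s _.
by apply/(submoduleZ subP)/(submodule_act subP).
Qed.

Lemma group_span_id v : group_span v v.
Proof.
exists (fun s => (s == 1%g)%:R); rewrite (bigD1 1%g) //= eqxx scale1r act1.
by rewrite big1 ?addr0 // => s /negbTE ->; rewrite scale0r.
Qed.

(* [E] is the coefficient of the tabloid [m0]. *)
Variables (m0 : U) (E : {scalar U}).
Hypothesis act_m0 : forall p, p \in Row -> act p m0 = m0.
Hypothesis E_m0 : forall s, E (act s m0) = (s \in Row)%:R.

Definition polytabloid := col_alt m0.
(** The image of [m0] under the Young symmetrizer. *)
Definition spherical := row_sum polytabloid.

Lemma act_polytabloid q : q \in Col -> act q polytabloid = sgn q *: polytabloid.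
Proof. exact: act_col_alt. Qed.

(** As a function of [g], the left-hand side is invariant under Row on the left
    and alternating under Col on the right. *)
Lemma row_sum_polytabloid g : row_sum (act g polytabloid) = y g *: spherical.
Proof.
have -> : spherical = row_sum (act 1%g polytabloid) by rewrite act1.
apply: (@young_symmetrizer_unique k n hk C _ (fun g => row_sum (act g polytabloid))).
  by move=> p s Rp; rewrite actM row_sumE.
by move=> s q Cq; rewrite actM act_polytabloid // !linearZ.
Qed.

(** The inverse puts the row group, which fixes [m0], on the left of [g]. *)
Lemma col_alt_act_m0 g : col_alt (act g^-1 m0) = y g *: polytabloid.
Proof.
have -> : polytabloid = col_alt (act 1^-1 m0) by rewrite invg1 act1.
apply: (@young_symmetrizer_unique k n hk C _ (fun g => col_alt (act g^-1 m0))).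
  by move=> p s Rp; rewrite permoV actM act_m0 // row_stabV.
by move=> s q Cq; rewrite permoV actM col_altE ?col_stabV // odd_permV.
Qed.

Lemma spherical_fixed p : p \in Row -> act p spherical = spherical.
Proof. exact: act_row_sum. Qed.

Lemma E_polytabloid : E polytabloid = 1.
Proof.
rewrite linear_sum (bigD1 1%g) ?col_stab1 //= big1 ?addr0 => [|q /andP[Cq nq]].
  by rewrite linearZ /= act1 -(act1 m0) E_m0 row_stab1 // odd_perm1 mulr1.
rewrite linearZ /= E_m0; case: (boolP (q \in Row)) => [Rq|_]; last by rewrite mulr0.
by rewrite (row_col_stab1 hk Rq Cq) eqxx in nq.
Qed.

Lemma E_spherical : E spherical = #|Row|%:R.
Proof.
rewrite linear_sum /= -sum1_card natr_sum; apply: eq_bigr => p Rp.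
rewrite !linear_sum (bigD1 1%g) ?col_stab1 //= big1 ?addr0 => [|q /andP[Cq nq]].
  by rewrite odd_perm1 act1 scale1r E_m0 Rp.
rewrite !linearZ /= -actM E_m0 (row_stab_permol hk) //.
case: (boolP (q \in Row)) => [Rq|_]; last by rewrite mulr0.
by rewrite (row_col_stab1 hk Rq Cq) eqxx in nq.
Qed.

(** Expanding along the tabloids [act s m0], each of which is met by as many
    [s] as there are row permutations, this is that number times the hermitian
    form for which the distinct tabloids are orthonormal. *)
Definition tabloid_form u v := \sum_s E (act s^-1 u) * (E (act s^-1 v))^*.

Lemma tabloid_form_linear v a u1 u2 :
  tabloid_form (a *: u1 + u2) v = a * tabloid_form u1 v + tabloid_form u2 v.
Proof.
rewrite mulr_sumr -big_split; apply: eq_bigr => s _ /=.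
by rewrite !linearP /= mulrDl mulrA.
Qed.

Lemma tabloid_formC u v : tabloid_form v u = (tabloid_form u v)^*.
Proof.
rewrite rmorph_sum; apply: eq_bigr => s _.
by rewrite rmorphM /= conjCK mulrC.
Qed.

Lemma tabloid_form_ge0 u : 0 <= tabloid_form u u.
Proof. by apply: sumr_ge0 => s _; apply: mul_conjC_ge0. Qed.

Lemma tabloid_form_eq0 u : tabloid_form u u = 0 -> forall s, E (act s u) = 0.
Proof.
move/eqP; rewrite psumr_eq0 => [|s _]; last exact: mul_conjC_ge0.
move=> /allP H s; have := H s^-1%g (mem_index_enum _).
by rewrite invgK mul_conjC_eq0 => /eqP.
Qed.

Lemma tabloid_form_act g u v : tabloid_form (act g u) (act g v) = tabloid_form u v.
Proof.
rewrite /tabloid_form [LHS](reindex_inj (@permo_inj _ g)) /=.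
by apply: eq_bigr => s _; rewrite permoV !actM !act_invK.
Qed.

Lemma tabloid_form_sum (I : finType) (P : pred I) (F : I -> U) v :
  tabloid_form (\sum_(i | P i) F i) v = \sum_(i | P i) tabloid_form (F i) v.
Proof.
rewrite exchange_big; apply: eq_bigr => s _.
by rewrite !linear_sum mulr_suml.
Qed.

Lemma tabloid_formZ a u v : tabloid_form (a *: u) v = a * tabloid_form u v.
Proof. by rewrite mulr_sumr; apply: eq_bigr => s _; rewrite !linearZ mulrA. Qed.

Lemma tabloid_form_sumr (I : finType) (P : pred I) (F : I -> U) v :
  tabloid_form v (\sum_(i | P i) F i) = \sum_(i | P i) tabloid_form v (F i).
Proof.
rewrite tabloid_formC tabloid_form_sum rmorph_sum.
by apply: eq_bigr => i _; rewrite [RHS]tabloid_formC.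
Qed.

Lemma tabloid_formZr a u v : tabloid_form u (a *: v) = a^* * tabloid_form u v.
Proof. by rewrite tabloid_formC tabloid_formZ rmorphM [in RHS]tabloid_formC. Qed.

(** Because [spherical] is fixed by the row group, pairing it with itself gives
    a multiple of the pairing of [m0] with [col_alt spherical].  The former is
    nonzero because [E spherical] is. *)
Lemma col_alt_spherical :
  exists2 c, c != 0 & col_alt spherical = c *: polytabloid.
Proof.
have [c Ec] : exists c, col_alt spherical = c *: polytabloid.
  exists (\sum_(p in Row) \sum_(q in Col) sgn q * y (permo p q)^-1%g).
  rewrite /spherical linear_sum scaler_suml; apply: eq_bigr => p Rp.
  rewrite scaler_suml !linear_sum; apply: eq_bigr => q Cq /=.
  by rewrite !linearZ /= -actM -[permo p q]invgK col_alt_act_m0 scalerA invgK.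
exists c => //; apply/eqP => c0.
suff /tabloid_form_eq0/(_ 1%g) : tabloid_form spherical spherical = 0.
  by rewrite act1 E_spherical => /eqP; rewrite gt_eqF ?card_row_gt0.
rewrite {1}/spherical tabloid_form_sum big1 // => p Rp.
rewrite -(tabloid_form_act p^-1) act_invK spherical_fixed ?row_stabV //.
transitivity (tabloid_form m0 (col_alt spherical)); last first.
  by rewrite Ec c0 scale0r /tabloid_form big1 // => s _; rewrite !linear0 conjC0 mulr0.
rewrite tabloid_form_sum tabloid_form_sumr [RHS](reindex_inj invg_inj) /=.
apply: eq_big => [q|q Cq]; first by rewrite col_stabV.
rewrite tabloid_formZ tabloid_formZr -(tabloid_form_act q^-1) act_invK odd_permV.
by rewrite rmorph_sign.
Qed.

Lemma spherical_span_polytabloid : group_span polytabloid spherical.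
Proof.
have sub := group_span_submodule polytabloid.
apply: (submodule_sum sub) => p _; apply: (submodule_act sub) => //.
exact: group_span_id.
Qed.

(** The alternating sum of [spherical] leads back to a nonzero multiple of the
    polytabloid. *)
Lemma polytabloid_span_spherical u :
  group_span polytabloid u <-> group_span spherical u.
Proof.
have sub := group_span_submodule spherical.
split; last first.
  apply: group_span_min; first exact: group_span_submodule.
  exact: spherical_span_polytabloid.
apply: group_span_min => //; have [c nc Ec] := col_alt_spherical.
rewrite -[polytabloid]scale1r -(mulVf nc) -scalerA -Ec.
apply/(submoduleZ sub)/(submodule_sum sub) => q _.
by apply/(submoduleZ sub)/(submodule_act sub) => //; apply: group_span_id.
Qed.

Lemma row_sum_span u : group_span polytabloid u ->
  exists c, row_sum u = c *: spherical.
Proof.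
move=> [z ->]; exists (\sum_s z s * y s); rewrite linear_sum scaler_suml.
by apply: eq_bigr => s _; rewrite linearZ /= row_sum_polytabloid scalerA.
Qed.

Lemma E_row_stable u p : group_span polytabloid u -> p \in Row -> E (act p u) = E u.
Proof.
move=> [z ->] Rp; rewrite !linear_sum; apply: eq_bigr => s _.
rewrite !linearZ /=; congr (_ * _); rewrite !linear_sum; apply: eq_bigr => q _.
by rewrite !linearZ -!actM !E_m0 -permoA (row_stab_permol hk _ Rp).
Qed.

Lemma E_row_sum u : group_span polytabloid u -> E (row_sum u) = #|Row|%:R * E u.
Proof.
move=> Su; rewrite linear_sum (eq_bigr (fun=> E u)) ?sumr_const ?mulr_natl //.
by move=> p Rp; apply: E_row_stable.
Qed.


Lemma polytabloid_span_tabloid u : group_span polytabloid u -> group_span m0 u.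
Proof.
apply: group_span_min; first exact: group_span_submodule.
apply: (submodule_sum (group_span_submodule m0)) => q _.
exists (fun s => (s == q)%:R * sgn q); rewrite (bigD1 q) //= eqxx mul1r.
by rewrite big1 ?addr0 // => s /negbTE->; rewrite mul0r scale0r.
Qed.

(** The sum of the [E (act s^-1 u) *: act s m0] recovers [u] up to the order of
    the row group. *)
Lemma span_eq0 u : group_span polytabloid u -> (forall s, E (act s u) = 0) -> u = 0.
Proof.
move=> /polytabloid_span_tabloid[z Eu] E0.
have: #|Row|%:R *: u = \sum_s E (act s^-1 u) *: act s m0.
  rewrite [in RHS]Eu; under [RHS]eq_bigr => s _ do
    rewrite !linear_sum scaler_suml /=.
  rewrite exchange_big Eu scaler_sumr; apply: eq_bigr => t _ /=.
  under eq_bigr => s _ do rewrite !linearZ /= -actM E_m0 -scalerA.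
  rewrite -scaler_sumr scalerA mulrC -scalerA; congr (_ *: _).
  have Vt s : permo (permo t s)^-1 t = s^-1%g.
    by rewrite permoV -permoA /permo mulgV mul1g.
  rewrite (reindex_inj (@permo_inj _ t)) /= (bigID (fun s => s \in Row)) /=.
  rewrite [X in _ + X]big1 ?addr0 => [|s /negbTE nRs]; last first.
    by rewrite Vt (row_stabV hk) nRs scale0r.
  rewrite (eq_bigr (fun=> act t m0)) ?sumr_const ?scaler_nat // => s Rs.
  by rewrite Vt (row_stabV hk) Rs scale1r actM act_m0.
rewrite big1 => [/eqP|s _]; last by rewrite E0 scale0r.
by rewrite scaler_eq0 gt_eqF ?card_row_gt0 //= => /eqP.
Qed.

(** A nonzero [u] has a translate on which [E] does not vanish.  The row sum of
    this translate is then a nonzero multiple of [spherical], so every nonzero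
    submodule contains [spherical]. *)
Lemma span_irreducible : is_irreducible (fun=> True) act (group_span polytabloid).
Proof.
split; first exact: group_span_submodule.
  exists polytabloid; first exact: group_span_id.
  apply/eqP => e0; have := E_polytabloid.
  by rewrite e0 linear0 => /eqP; rewrite eq_sym oner_eq0.
move=> W subW WS; case: (boolp.lem (exists2 u, W u & u != 0)) => [[u Wu nu]|nW];
  [right | left => u Wu]; last first.
  by apply/eqP; apply: contraPT nW => nu; case; exists u.
have [s nEs] : exists s, E (act s u) != 0.
  apply/existsP; apply: contraNT nu; rewrite negb_exists => /forallP E0.
  apply/eqP/span_eq0; first exact: WS.
  by move=> s; apply/eqP; rewrite -[_ == _]negbK E0.
have Wsu : W (act s u) by apply: (submodule_act subW).
have [c Ec] := row_sum_span (WS _ Wsu).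
have nc : c != 0.
  apply/eqP => c0; have := E_row_sum (WS _ Wsu).
  rewrite Ec c0 scale0r linear0 => /esym/eqP.
  by rewrite mulf_eq0 (negbTE nEs) gt_eqF ?card_row_gt0.
move=> v /polytabloid_span_spherical; apply: group_span_min => //.
rewrite -[spherical]scale1r -(mulVf nc) -scalerA -Ec.
by apply/(submoduleZ subW)/(submodule_sum subW) => p _; apply: (submodule_act subW).
Qed.

Lemma tabloid_form_inner_product :
  invariant_inner_product act (group_span polytabloid) tabloid_form.
Proof.
split=> [a u v w _ _ _|u v _ _|u Su nu|g u v _ _].
- exact: tabloid_form_linear.
- exact: tabloid_formC.
- rewrite lt_def tabloid_form_ge0 andbT; apply: contraNneq nu => f0.
  by apply/eqP/span_eq0 => //; apply: tabloid_form_eq0.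
- exact: tabloid_form_act.
Qed.

Lemma row_sum_act_spherical g :
  row_sum (act g spherical) = (E (act g spherical)) *: spherical.
Proof.
have Sw : group_span polytabloid (act g spherical).
  have [_ _ + ] := group_span_submodule polytabloid; apply => //.
  exact: spherical_span_polytabloid.
have [c Ec] := row_sum_span Sw; rewrite Ec; congr (_ *: _).
have := E_row_sum Sw; rewrite Ec linearZ /= E_spherical mulrC.
by apply: mulfI; rewrite gt_eqF ?card_row_gt0.
Qed.

(** Averaging over the row group turns [act g spherical] into a multiple of
    [spherical] without changing its pairing with [spherical]. *)
Lemma inner_product_spherical ip :
  invariant_inner_product act (group_span polytabloid) ip ->
  forall g, ip (act g spherical) spherical / ip spherical spherical
            = E (act g spherical) / E spherical.
Proof.
move=> ipP g; have sub := group_span_submodule polytabloid.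
have Sw := spherical_span_polytabloid.
have Sg s u : group_span polytabloid u -> group_span polytabloid (act s u).
  exact: (submodule_act sub).
have nw : spherical != 0.
  apply: contraTneq card_row_gt0 => w0; rewrite -E_spherical w0 linear0.
  by rewrite ltxx.
have : ip (row_sum (act g spherical)) spherical
       = #|Row|%:R * ip (act g spherical) spherical.
  rewrite (inner_product_sum sub ipP) // => [|s]; last exact/Sg/Sg.
  rewrite mulr_natl -sumr_const; apply: eq_bigr => p Rp.
  by rewrite -[RHS](inner_product_act ipP p) ?(spherical_fixed Rp) //; apply: Sg.
rewrite row_sum_act_spherical (inner_productZ sub ipP) // => Eip; rewrite E_spherical.
have nR : #|Row|%:R != 0 :> C by rewrite gt_eqF ?card_row_gt0.
apply: (mulfI nR); rewrite [in RHS]mulrCA divff // mulr1 mulrA -Eip mulfK //.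
by rewrite gt_eqF // (inner_product_gt0 ipP).
Qed.

(** The action on [m0] of an element of the group algebra. *)
Definition tabloid_map (z : grp_alg C N) : U := \sum_s z s *: act s m0.

Lemma tabloid_map_linear : linear tabloid_map.
Proof.
move=> a u v; rewrite scaler_sumr -big_split; apply: eq_bigr => s _ /=.
by rewrite !ffunE scalerDl scalerA.
Qed.
HB.instance Definition _ :=
  GRing.isLinear.Build C (grp_alg C N) U *:%R tabloid_map tabloid_map_linear.

Lemma tabloid_map_transl g z : tabloid_map (left_transl g z) = act g (tabloid_map z).
Proof.
rewrite /tabloid_map linear_sum [LHS](reindex_inj (@permo_inj _ g)) /=.
by apply: eq_bigr => s _; rewrite ffunE permoK linearZ actM.
Qed.

Lemma tabloid_map_young : tabloid_map y = spherical.
Proof.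
rewrite /tabloid_map /spherical /row_sum.
under eq_bigr => s _ do rewrite ffunE scaler_suml.
rewrite exchange_big; apply: eq_bigr => p _ /=.
under eq_bigr => s _ do rewrite scaler_suml big_mkcondr.
rewrite exchange_big /polytabloid /col_alt linear_sum; apply: eq_bigr => q _ /=.
rewrite (bigD1 (permo p q)) //= eqxx big1 ?addr0 => [|s /negbTE -> //].
by rewrite actM linearZ.
Qed.

Lemma tabloid_map_conv (a : grp_alg C N) z :
  tabloid_map (conv a z) = \sum_t a t *: act t (tabloid_map z).
Proof.
rewrite /tabloid_map; under eq_bigr => s _ do rewrite ffunE scaler_suml.
rewrite exchange_big; apply: eq_bigr => t _ /=.
rewrite linear_sum scaler_sumr (reindex_inj (@permo_inj _ t)) /=.
by apply: eq_bigr => s _; rewrite permoK linearZ /= scalerA actM.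
Qed.

(** The map from the Specht module to the span of the polytabloids is inverted,
    up to a nonzero factor, by the coefficient of [m0] in the
    column-alternating sum of the translates. *)
Lemma specht_isomorphic :
  isomorphic (fun=> True) (@left_transl C N) (@specht C N la)
    act (group_span polytabloid).
Proof.
exists tabloid_map; split=> [z [a Ez]|u|g z _ _]; last exact: tabloid_map_transl.
  move=> z0; have [c nc Ec] := col_alt_spherical.
  have Ey s : E (col_alt (act s^-1 spherical)) = c * y s.
    have -> : c = E (col_alt (act 1^-1 spherical)).
      by rewrite invg1 act1 Ec linearZ /= E_polytabloid mulr1.
    rewrite mulrC.
    apply: (@young_symmetrizer_unique k n hk C C^o
              (fun s => E (col_alt (act s^-1 spherical)))) => [p t Rp|t q Cq].
      by rewrite permoV actM spherical_fixed ?row_stabV.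
    by rewrite permoV actM col_altE ?col_stabV // linearZ odd_permV.
  apply/ffunP => s; rewrite ffunE; apply: (mulfI nc); rewrite mulr0.
  have <- : E (col_alt (act s^-1 (tabloid_map z))) = c * z s.
    rewrite Ez tabloid_map_conv tabloid_map_young ffunE mulr_sumr.
    rewrite (linear_sum (act s^-1)) (linear_sum col_alt) (linear_sum E).
    apply: eq_bigr => t _; rewrite !linearZ /= -actM.
    by rewrite -[permo _ t]invgK Ey mulrCA permoV invgK.
  by rewrite z0 !linear0.
rewrite polytabloid_span_spherical; split=> [[z ->]|[_ [a ->] ->]].
  exists (conv [ffun s => z s] y); first by eexists.
  rewrite /= tabloid_map_conv tabloid_map_young.
  by apply: eq_bigr => s _; rewrite ffunE.
by exists a; rewrite /= tabloid_map_conv tabloid_map_young.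
Qed.

(** The quadratic form attached to such a matrix element is the square norm of a
    combination of translates of [spherical]. *)
Lemma spherical_positive_definite :
  positive_definite (fun g => tabloid_form (act g spherical) spherical
                              / tabloid_form spherical spherical).
Proof.
move=> c; pose u := \sum_g c g *: act g spherical.
suff -> : \sum_g \sum_h c g * (c h)^* *
    (tabloid_form (act (permo h^-1 g) spherical) spherical
      / tabloid_form spherical spherical)
    = tabloid_form u u / tabloid_form spherical spherical.
  by apply: divr_ge0; apply: tabloid_form_ge0.
have -> : tabloid_form u u = \sum_g \sum_h
    c g * ((c h)^* * tabloid_form (act g spherical) (act h spherical)).
  rewrite [LHS]tabloid_form_sum; apply: eq_bigr => g _.
  rewrite tabloid_formZ [tabloid_form _ u]tabloid_form_sumr mulr_sumr.
  by apply: eq_bigr => h _; rewrite tabloid_formZr.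
rewrite mulr_suml; apply: eq_bigr => g _; rewrite mulr_suml; apply: eq_bigr => h _.
by rewrite actM -(tabloid_form_act h) act_invKV !mulrA.
Qed.

(** Writing the weight of [s] as a signed number of colourings fixed by [s]
    turns the sum into one over colourings [c], with the alternating sum over
    the stabiliser of [c] for each.  It vanishes as soon as two cells of a row
    have the same colour; the other colourings are the translates of the
    colouring by columns under the row group. *)
Lemma alpha_sum_spherical :
  \sum_s (- k%:R^-1) ^+ (N - #|porbits s|) *: act s m0
  = (k%:R ^- N : C) *: spherical.
Proof.
pose fixes (c : {ffun 'I_N -> 'I_k}) (s : 'S_N) := [forall x, c (s x) == c x].
pose alt c := \sum_(s | fixes c s) sgn s *: act s m0.
have nk : k%:R != 0 :> C by rewrite pnatr_eq0 -lt0n.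
transitivity ((k%:R ^- N : C) *: \sum_c alt c).
  rewrite /alt (exchange_big_dep predT) //= scaler_sumr; apply: eq_bigr => s _.
  rewrite alpha_weight // sumr_const -scaler_nat !scalerA mulrAC.
  congr (_ * _%:R * _ *: _).
  by apply: eq_card => c; rewrite inE.
congr (_ *: _).
pose h (p : 'S_N) : {ffun 'I_N -> 'I_k} := [ffun x => offset_of hk (p^-1%g x)].
have injh : {in Row &, injective h}.
  move=> p p' Rp Rp' /ffunP eqh; apply: invg_inj; apply/permP => x.
  apply: (@cell_inj _ _ hk); last by have := eqh x; rewrite !ffunE.
  have /(row_stabP hk) -> : p^-1%g \in Row by rewrite (row_stabV hk).
  by have /(row_stabP hk) -> : p'^-1%g \in Row by rewrite (row_stabV hk).
rewrite (bigID (fun c => c \in [set h p | p in Row])) /=.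
rewrite [X in _ + X]big1 ?addr0 => [|c nhc]; last first.
  have /injectivePn[x [z nxz eqxz]] :
      ~~ injectiveb (fun x => cell (block_of x) (c x)).
    apply: contra nhc => /injectiveP inj; apply/imsetP.
    exists (perm inj)^-1%g; last first.
      by apply/ffunP => x; rewrite ffunE invgK permE offset_of_cell.
    rewrite (row_stabV hk); apply/(row_stabP hk) => x.
    by rewrite permE block_of_cell.
  have bxz : block_of x = block_of z.
    by have := congr1 (@block_of k n) eqxz; rewrite !block_of_cell.
  have cxz : c x = c z.
    by have := congr1 (offset_of hk) eqxz; rewrite !offset_of_cell.
  pose t := tperm x z.
  have ct u : c (t u) = c u by rewrite /t; case: tpermP => [->|->|].
  have Rt : t \in Row.
    by apply/(row_stabP hk) => u; rewrite /t; case: tpermP => [->|->|].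
  suff : alt c = - alt c.
    move/eqP; rewrite -subr_eq0 opprK -mulr2n -scaler_nat scaler_eq0 pnatr_eq0.
    by move/eqP.
  rewrite {1}/alt (reindex_inj (@permo_injl _ t)) /= /alt -sumrN.
  apply: eq_big => [s|s _].
    apply/forallP/forallP => Hs u.
      by have := Hs (t u); rewrite permoE tpermK ct.
    by rewrite permoE (eqP (Hs _)) ct.
  by rewrite actM act_m0 // /permo odd_permM odd_tperm nxz signrN scaleNr.
rewrite big_imset //=. apply: eq_bigr => p Rp.
rewrite /alt (reindex_inj (@permo_inj _ p)) (reindex_inj (@permo_injl _ p^-1)) /=.
rewrite /polytabloid /col_alt linear_sum; apply: eq_big => [q|q _].
  apply/forallP/(col_stabP hk) => Hq u.
    by have := eqP (Hq (p u)); rewrite !ffunE !permoE !permK.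
  by rewrite !ffunE !permoE permK Hq.
rewrite !actM act_m0 ?(row_stabV hk) // linearZ /permo !odd_permM odd_permV.
by rewrite addbAC addbb.
Qed.

End Tabloid.

(** * Polynomial functions on matrices *)

Lemma poly_eq0_of_eval (F : numFieldType) (p : {poly F}) :
  (forall x, x != 0 -> p.[x] = 0) -> p = 0.
Proof.
move=> p0; apply: (@roots_geq_poly_eq0 _ p [seq i.+1%:R | i <- iota 0 (size p)]).
- by apply/allP => _ /mapP[i _ ->]; rewrite /root p0 // pnatr_eq0.
- rewrite map_inj_in_uniq ?iota_uniq // => i j _ _ /eqP.
  by rewrite eqr_nat eqSS => /eqP.
- by rewrite size_map size_iota.
Qed.

Lemma mpoly_eq0_of_eval (F : numFieldType) n (p : {mpoly F[n]}) :
  (forall v, p.@[v] = 0) -> p = 0.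
Proof.
elim: n p => [|n IH] p p0; apply/mpolyP => m; rewrite mcoeff0.
  have := p0 (fun=> 0); rewrite mevalE.
  have m0 (m' : 'X_{1..0}) : m' = m by apply/mnmP; case.
  case: (boolP (m \in msupp p)) => [mp|]; last by move/memN_msupp_eq0.
  rewrite (bigD1_seq m) ?msupp_uniq //= big_ord0 mulr1.
  by rewrite big1 ?addr0 // => m' nm; rewrite (m0 m') eqxx in nm.
pose wd (i : 'I_n) := widen_ord (leqnSn n) i.
have wdE i : wd i = lift ord_max i.
  by apply/val_inj; rewrite /= /bump leqNgt ltn_ord.
pose rst (m' : 'X_{1..n.+1}) := [multinom m' (wd i) | i < n].
(* [q j] is the coefficient of the j-th power of the last variable. *)
pose q j := \sum_(m' <- msupp p | m' ord_max == j) p@_m' *: 'X_[rst m'].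
have q0 j : q j = 0.
  apply: IH => v; rewrite rmorph_sum /=.
  pose Q := \sum_(m' <- msupp p)
    (p@_m' * \prod_(i < n) v i ^+ m' (wd i)) *: 'X^(m' ord_max) : {poly F}.
  have Q0 : Q = 0.
    apply: poly_eq0_of_eval => x _.
    rewrite -[RHS](p0 (fun i => if unlift ord_max i is Some i' then v i' else x)).
    rewrite mevalE horner_sum; apply: eq_bigr => m' _.
    rewrite hornerZ hornerXn big_ord_recr /= unlift_none mulrA; congr (_ * _ * _).
    by apply: eq_bigr => i _; rewrite -/(wd i) wdE liftK.
  transitivity Q`_j; last by rewrite Q0 coef0.
  rewrite coef_sum big_mkcond; apply: eq_bigr => m' _.
  rewrite coefZ coefXn eq_sym; case: eqP => _; rewrite ?mulr0 // mulr1.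
  rewrite mevalZ mevalX; congr (_ * _).
  by apply: eq_bigr => i _; rewrite mnmE.
have := q0 (m ord_max) => /(congr1 (mcoeff (rst m))); rewrite mcoeff0 => <-.
rewrite raddf_sum /= big_mkcond /=.
case: (boolP (m \in msupp p)) => [mp|/memN_msupp_eq0 pm].
  rewrite (bigD1_seq m) ?msupp_uniq //= eqxx mcoeffZ mcoeffX eqxx mulr1.
  rewrite big1 ?addr0 // => m' nm; case: eqP => // em.
  rewrite mcoeffZ mcoeffX; case: eqP => [er|_]; rewrite ?mulr0 //.
  case/eqP: nm; apply/mnmP => i; case: (unliftP ord_max i) => [j|] -> //.
  by have /mnmP/(_ j) := er; rewrite !mnmE wdE.
rewrite big_seq big1 // => m' mp'; case: eqP => // em.
rewrite mcoeffZ mcoeffX; case: eqP => [er|_]; rewrite ?mulr0 //.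
have em' : m' = m.
  apply/mnmP => i; case: (unliftP ord_max i) => [j|] -> //.
  by have /mnmP/(_ j) := er; rewrite !mnmE wdE.
by rewrite em' pm mul0r.
Qed.

Lemma eval_mx_inj (F : numFieldType) m n (f g : {mpoly F[m * n]}) :
  (forall A, eval_mx f A = eval_mx g A) -> f = g.
Proof.
move=> fg; apply/eqP; rewrite -subr_eq0; apply/eqP/mpoly_eq0_of_eval => v.
have ev h : eval_mx h (vec_mx (\row_i v i)) = h.@[v].
  by apply: meval_eq => i; rewrite vec_mxK mxE.
by rewrite rmorphB /= -!ev fg subrr.
Qed.

Lemma mpoly_lrmorphism_ext (F : fieldType) p (A : lalgType F)
    (f g : {lrmorphism {mpoly F[p]} -> A}) :
  (forall i, f 'X_i = g 'X_i) -> f =1 g.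
Proof.
move=> fg q; rewrite [q]mpolyE !linear_sum; apply: eq_bigr => a _ /=.
rewrite !linearZ /= mpolyXE_id !rmorph_prod; congr (_ *: _); apply: eq_bigr => i _.
by rewrite !rmorphXn /= fg.
Qed.

Section Action.
Variables (F : fieldType) (m n : nat).
Local Notation X := (Xmx F m n).
Implicit Types (gh : 'M[F]_m * 'M[F]_n) (f : {mpoly F[m * n]}).

(** The matrix of the polynomials substituted for the coordinates by
    [gl_act gh]. *)
Definition gl_point gh :=
  map_mx (@mpolyC (m * n) F) gh.1^T *m X *m map_mx (@mpolyC (m * n) F) gh.2.

HB.instance Definition _ gh := GRing.LRMorphism.copy (@gl_act F m n gh)
  (comp_mpoly [tuple mxvec (gl_point gh) 0 i | i < m * n]).

Lemma XmxE i j : X i j = 'X_(mxvec_index i j).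
Proof. by rewrite !mxE. Qed.

Lemma gl_act_Xmx gh i j : gl_act gh (X i j) = gl_point gh i j.
Proof.
by rewrite XmxE /gl_act comp_mpolyXU -tnth_nth tnth_mktuple mxvecE.
Qed.

Lemma map_gl_act_Xmx gh : map_mx (gl_act gh) X = gl_point gh.
Proof. by apply/matrixP => i j; rewrite mxE gl_act_Xmx. Qed.

Lemma gl_actC gh c : gl_act gh c%:MP = c%:MP.
Proof. exact: comp_mpolyC. Qed.

Lemma map_gl_actC p q gh (A : 'M[F]_(p, q)) :
  map_mx (gl_act gh) (map_mx (@mpolyC (m * n) F) A) = map_mx (@mpolyC (m * n) F) A.
Proof. by apply/matrixP => i j; rewrite !mxE gl_actC. Qed.

Lemma eval_gl_act gh f A : eval_mx (gl_act gh f) A = eval_mx f (gh.1^T *m A *m gh.2).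
Proof.
rewrite /eval_mx /gl_act comp_mpoly_meval; apply: meval_eq => i.
rewrite tnth_mktuple; case/mxvec_indexP: i => i j; rewrite !mxvecE.
have -> : (gl_point gh i j).@[fun i => mxvec A 0 i]
  = map_mx (meval (fun i => mxvec A 0 i)) (gl_point gh) i j by rewrite [RHS]mxE.
rewrite /gl_point !map_mxM; congr ((_ *m _ *m _) i j); apply/matrixP => a b.
- by rewrite !mxE /= mevalC.
- by rewrite mxE /= XmxE mevalXU mxvecE.
- by rewrite !mxE /= mevalC.
Qed.

Lemma gl_act1 f : gl_act (1%:M, 1%:M) f = f.
Proof.
rewrite -[RHS]comp_mpoly_id /gl_act; congr (f \mPo _); apply: eq_from_tnth => i.
rewrite !tnth_mktuple /= trmx1 !map_mx1 mul1mx mulmx1.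
by rewrite vec_mxK mxE.
Qed.

Lemma eval_Xmx i j A : eval_mx (X i j) A = A i j.
Proof. by rewrite /eval_mx XmxE mevalXU mxvecE. Qed.

Lemma gl_actZ gh a f : gl_act gh (a *: f) = a *: gl_act gh f.
Proof. exact: linearZ. Qed.

Lemma gl_act_sum (I : finType) (P : pred I) gh (f_ : I -> {mpoly F[m * n]}) :
  gl_act gh (\sum_(i | P i) f_ i) = \sum_(i | P i) gl_act gh (f_ i).
Proof. exact: linear_sum. Qed.

(** Both sides are algebra morphisms in [f], so it is enough to compare them on
    the coordinates. *)
Lemma gl_actM gh gh' f :
  gl_act gh (gl_act gh' f) = gl_act (gh.1 *m gh'.1, gh.2 *m gh'.2) f.
Proof.
apply: (@mpoly_lrmorphism_ext _ _ _ (gl_act gh \o gl_act gh') (gl_act _)) => i /=.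
case/mxvec_indexP: i => i j.
rewrite -XmxE !gl_act_Xmx; transitivity (map_mx (gl_act gh) (gl_point gh') i j).
  by rewrite [RHS]mxE.
rewrite /gl_point !map_mxM !map_gl_actC map_gl_act_Xmx /gl_point /= trmx_mul.
by rewrite !map_mxM !mulmxA.
Qed.

End Action.

(** * Tabloids of polynomials *)

Section Monomials.
Variables (F : fieldType) (k n : nat).
Local Notation N := (k * n)%N.
Local Notation X := (Xmx F N n).
Local Notation Row := (row_stab N (nseq n k)).

HB.instance Definition _ s := GRing.LRMorphism.copy (@sym_act F N n s)
  (gl_act (permutation_matrix F s, 1%:M)).

Lemma permutation_matrixE (s : 'S_N) : permutation_matrix F s = (perm_mx s)^T.
Proof. by apply/matrixP => i j; rewrite !mxE eq_sym. Qed.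

Lemma permutation_matrix_unit (s : 'S_N) : permutation_matrix F s \in unitmx.
Proof. by rewrite permutation_matrixE unitmx_tr unitmx_perm. Qed.

Lemma sym_act_Xmx s i j : sym_act s (X i j) = X (s i) j.
Proof.
rewrite /sym_act gl_act_Xmx /gl_point /= permutation_matrixE trmxK map_mx1 mulmx1.
by rewrite map_perm_mx -row_permE mxE.
Qed.

Lemma sym_act1 f : @sym_act F N n 1 f = f.
Proof.
rewrite /sym_act permutation_matrixE perm_mx1 trmx1.
by apply: gl_act1.
Qed.

Lemma sym_actM s t f : @sym_act F N n (permo s t) f = sym_act s (sym_act t f).
Proof.
have E : permutation_matrix F (permo s t)
         = permutation_matrix F s *m permutation_matrix F t.
  by rewrite !permutation_matrixE -trmx_mul -perm_mxM.
by rewrite /sym_act gl_actM mulmx1 -E.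
Qed.

Definition block_monomial : {mpoly F[N * n]} := \prod_i X i (block_of i).

Lemma sym_act_block_monomial s :
  sym_act s block_monomial = \prod_i X (s i) (block_of i).
Proof.
by rewrite /block_monomial rmorph_prod; apply: eq_bigr => i _; rewrite /= sym_act_Xmx.
Qed.

(** Among the monomials of degree one in each row, only [block_monomial] does not
    vanish here, so that evaluation at this point reads off its coefficient. *)
Definition block_point : 'M[F]_(N, n) := \matrix_(i, j) (block_of i == j)%:R.

Definition eval_block (f : {mpoly F[N * n]}) : F := eval_mx f block_point.

HB.instance Definition _ := GRing.LRMorphism.copy eval_block
  (meval (fun i => mxvec block_point 0 i)).

Lemma block_monomial_fixed (hk : (0 < k)%N) p :
  p \in Row -> sym_act p block_monomial = block_monomial.
Proof.
move=> /(row_stabP hk) Rp; rewrite sym_act_block_monomial.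
rewrite /block_monomial [RHS](reindex_inj (@perm_inj _ p)) /=.
by apply: eq_bigr => i _; rewrite Rp.
Qed.

Lemma eval_block_monomial (hk : (0 < k)%N) s :
  eval_block (sym_act s block_monomial) = (s \in Row)%:R.
Proof.
rewrite sym_act_block_monomial rmorph_prod /=.
under eq_bigr => i _ do rewrite /eval_block eval_Xmx mxE.
case: (boolP (s \in Row)) => [/(row_stabP hk) Rs|nRs].
  by rewrite big1 // => i _; rewrite Rs eqxx.
have [i nbi] : exists i, block_of (s i) != block_of i.
  apply/existsP; apply: contraNT nRs; rewrite negb_exists => /forallP Rs.
  by apply/(row_stabP hk) => i; apply/eqP; have := Rs i; rewrite negbK.
by rewrite (bigD1 i) //= (negbTE nbi) mul0r.
Qed.

End Monomials.

(** * Powers of a determinant *)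

Section DetPower.
Variables (R : comNzRingType) (n : nat) (Y : 'M[R]_n).

(** Natural number indices, with the default value 0 out of range, let quotients
    and remainders index the blocks of [block_power] without casts. *)
Definition entry (a b : nat) : R :=
  if insub a is Some i then if insub b is Some j then Y i j else 0 else 0.

Lemma entryE (i j : 'I_n) : entry i j = Y i j.
Proof. by rewrite /entry !valK. Qed.

Definition block_power k : 'M[R]_(k * n) :=
  \matrix_(x, y) ((x %/ n == y %/ n)%N%:R * entry (x %% n) (y %% n)).

Lemma det_block_power k : \det (block_power k) = \det Y ^+ k.
Proof.
elim: k => [|k IH]; first by rewrite det_mx00.
rewrite exprS -IH -(det_ublock Y 0); congr (\det _).
apply/matrixP => x y.
have n_gt0 : (0 < n)%N.
  by move: (val x) (ltn_ord x) => z; case: (n) => //; rewrite muln0.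
have divnS a : ((n + a) %/ n = (a %/ n).+1)%N by rewrite divnDl // divnn n_gt0.
rewrite mxE; case: (@split_ordP n (k * n) x) => i ->;
  case: (@split_ordP n (k * n) y) => j ->.
- by rewrite block_mxEul /= !divn_small ?modn_small // eqxx mul1r entryE.
- by rewrite block_mxEur mxE /= divn_small // divnS mul0r.
- by rewrite block_mxEdl mxE /= divnS (divn_small (ltn_ord j)) mul0r.
- by rewrite block_mxEdr mxE /= !divnS eqSS !modnDl.
Qed.

Variables (k : nat) (hk : (0 < k)%N).
Local Notation N := (k * n)%N.

(** Relabelling the rows and columns of [block_power] by the cells of the
    rectangle, the r-th block being the r-th column, makes every permutation
    outside the column group contribute 0 to the determinant. *)
Lemma det_power_col_stab :
  \det Y ^+ k = \sum_(q in col_stab N (nseq n k)) (-1) ^+ odd_perm q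
     * \prod_x Y (block_of x) (block_of (q x)).
Proof.
have lt_s (x : 'I_N) : (offset_of hk x * n + block_of x < N)%N.
  apply: (@leq_trans ((offset_of hk x).+1 * n)).
    by rewrite mulSn [(n + _)%N]addnC ltn_add2l ltn_ord.
  by rewrite leq_mul2r ltn_ord orbT.
pose f x := Ordinal (lt_s x).
have fdiv x : (f x %/ n = offset_of hk x)%N.
  have n_gt0 : (0 < n)%N by apply: leq_ltn_trans (ltn_ord (block_of x)).
  by rewrite /= divnMDl // (divn_small (ltn_ord (block_of x))) addn0.
have fmod x : (f x %% n = block_of x)%N.
  by rewrite /= modnMDl (modn_small (ltn_ord (block_of x))).
have injf : injective f.
  move=> x z /(congr1 val) eqf; apply: (@cell_inj _ _ hk); apply/val_inj.
    by have := congr1 (modn^~ n) eqf; rewrite /= !fmod.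
  by have := congr1 (divn^~ n) eqf; rewrite /= !fdiv.
pose s := perm injf.
pose Z := \matrix_(x, y) ((offset_of hk x == offset_of hk y)%:R
                          * Y (block_of x) (block_of y)) : 'M[R]_N.
have -> : \det Y ^+ k = \det Z.
  have -> : Z = row_perm s (col_perm s (block_power k)).
    apply/matrixP => x y; rewrite !mxE !permE; congr (_ * _).
      by rewrite !fdiv.
    by rewrite !fmod entryE.
  rewrite row_permE col_permE !det_mulmx !det_perm odd_permV mulrC -mulrA.
  by rewrite -signr_addb addbb mulr1 det_block_power.
rewrite /determinant (bigID (fun q => q \in col_stab N (nseq n k))) /=.
rewrite [X in _ + X]big1 ?addr0 => [|q nCq]; last first.
  have [x nox] : exists x, offset_of hk (q x) != offset_of hk x.
    apply/existsP; apply: contraNT nCq; rewrite negb_exists => /forallP Cq.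
    by apply/(col_stabP hk) => x; apply/eqP; have := Cq x; rewrite negbK.
  by rewrite (bigD1 x) //= mxE eq_sym (negbTE nox) !mul0r mulr0.
apply: eq_bigr => q /(col_stabP hk) Cq; congr (_ * _); apply: eq_bigr => x _.
by rewrite mxE Cq eqxx mul1r.
Qed.

End DetPower.

(** * Multilinear parts of powers of minors *)

Section Multilinear.
Variables (C : numClosedFieldType) (k n : nat) (hk : (0 < k)%N).
Local Notation N := (k * n)%N.
Local Notation X := (Xmx C N n).
Local Notation Row := (row_stab N (nseq n k)).
Local Notation Col := (col_stab N (nseq n k)).
Local Notation sgn q := ((-1) ^+ odd_perm q : C).

Definition sym_action (s : 'S_N) : {linear {mpoly C[N * n]} -> {mpoly C[N * n]}} :=
  @sym_act C N n s.
Local Notation act := sym_action.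
Local Notation m0 := (block_monomial C k n).
Local Notation e := (polytabloid act m0).
Local Notation w' := (spherical act m0).

Definition minor_power (G : 'M[C]_(n, N)) : {mpoly C[N * n]} :=
  \det (map_mx (@mpolyC (N * n) C) G *m X) ^+ k.

Lemma gl_act_minor_power gh G :
  gl_act gh (minor_power G) = \det gh.2 ^+ k *: minor_power (G *m gh.1^T).
Proof.
rewrite /minor_power rmorphXn /= -det_map_mx map_mxM map_gl_actC map_gl_act_Xmx.
rewrite /gl_point !mulmxA det_mulmx -map_mxM det_map_mx mulrC exprMn.
by rewrite -rmorphXn /= mul_mpolyC.
Qed.

Definition sign_vector (t : {ffun 'I_N -> bool}) : 'rV[C]_N := \row_i (-1) ^+ t i.

(** The average over the sign changes of the rows, against the character given
    by the product of the signs, keeps the monomials of odd degree in each row;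
    on polynomials of degree N these are the multilinear ones. *)
Definition multilinear_part (f : {mpoly C[N * n]}) : {mpoly C[N * n]} :=
  (2 ^- N : C) *: \sum_t (\prod_i sign_vector t 0 i) *:
     gl_act (diag_mx (sign_vector t), 1%:M) f.

Lemma multilinear_part_linear : linear multilinear_part.
Proof.
move=> a f g; rewrite /multilinear_part scalerA mulrC -scalerA -scalerDr; congr (_ *: _).
rewrite scaler_sumr -big_split; apply: eq_bigr => t _ /=.
by rewrite linearP scalerDr !scalerA mulrC.
Qed.
HB.instance Definition _ := GRing.isLinear.Build C _ _ *:%R multilinear_part
  multilinear_part_linear.

Lemma multilinear_partZ a f : multilinear_part (a *: f) = a *: multilinear_part f.
Proof. exact: linearZ. Qed.

Lemma sign_vector_unit t : diag_mx (sign_vector t) \in unitmx.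
Proof.
rewrite unitmxE det_diag rpred_prod // => i _.
by rewrite mxE unitfE signr_eq0.
Qed.

(** If [p] misses [y], changing the sign at [y] is an involution that changes
    the sign of the product. *)
Lemma sum_sign_vectors (p : {ffun 'I_N -> 'I_N}) :
  \sum_t \prod_i (sign_vector t 0 i * sign_vector t 0 (p i))
  = (2 ^+ N) * (injectiveb p)%:R :> C.
Proof.
under eq_bigr => t _ do rewrite big_split /=.
case: (boolP (injectiveb p)) => [/injectiveP injp|ninjp].
  rewrite (eq_bigr (fun=> 1)) => [|t _].
    by rewrite sumr_const card_ffun card_bool card_ord mulr1 -natrX.
  have -> : \prod_i sign_vector t 0 (p i) = \prod_i sign_vector t 0 i.
    by rewrite [RHS](reindex_inj injp).
  by rewrite -big_split big1 // => i _; rewrite /= !mxE -signr_addb addbb.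
have [y ny] : exists y, y \notin codom p.
  apply/existsP; apply: contraNT ninjp; rewrite negb_exists => /forallP surj.
  have /image_injP injp : #|codom p| == #|'I_N|.
    by apply/eqP/eq_card => y; have := surj y; rewrite negbK => ->.
  by apply/injectiveP => x z; apply: injp.
rewrite mulr0; pose flip (t : {ffun 'I_N -> bool}) := [ffun i => t i (+) (i == y)].
have flipK : involutive flip.
  by move=> t; apply/ffunP => i; rewrite !ffunE -addbA addbb addbF.
set S := \sum_t _; suff : S = - S.
  by move/eqP; rewrite -subr_eq0 opprK -mulr2n mulrn_eq0 => /eqP.
rewrite {1}/S (reindex_inj (inv_inj flipK)) -sumrN; apply: eq_bigr => t _ /=.
have -> : \prod_i sign_vector (flip t) 0 (p i) = \prod_i sign_vector t 0 (p i).
  apply: eq_bigr => i _; rewrite !mxE ffunE; case: eqP => [py|_]; rewrite ?addbF //.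
  by rewrite -py codom_f in ny.
rewrite -mulNr; congr (_ * _); rewrite (bigD1 y) //= [in RHS](bigD1 y) //= -mulNr.
rewrite !mxE ffunE eqxx addbT signrN; congr (_ * _).
by apply: eq_bigr => i /negbTE ni; rewrite !mxE ffunE ni addbF.
Qed.

Lemma act_polytabloidE (s : 'S_N) :
  act s e = \sum_(q in Col) sgn q *: \prod_x X (s x) (block_of (q x)).
Proof.
rewrite /polytabloid /col_alt linear_sum (reindex_inj invg_inj) /=.
apply: eq_big => [q|q _]; first by rewrite (col_stabV hk).
rewrite linearZ /= odd_permV -sym_actM sym_act_block_monomial.
rewrite (reindex_inj (@perm_inj _ q)) /=; congr (_ *: _).
by apply: eq_bigr => x _; rewrite permoE permK.
Qed.

(** Expanding the determinant by columns and each entry of the product along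
    its row, a term chooses a row index [p x] for every cell [x]; only the
    bijective choices survive in the multilinear part. *)
Lemma multilinear_part_minor_power G :
  multilinear_part (minor_power G)
  = \sum_(s : 'S_N) (\prod_x G (block_of x) (s x)) *: act s e.
Proof.
pose M q (p : {ffun 'I_N -> 'I_N}) : {mpoly C[N * n]} :=
  \prod_x X (p x) (block_of (q x : 'I_N)).
have minorE t : minor_power (G *m (diag_mx (sign_vector t))^T)
  = \sum_(p : {ffun 'I_N -> 'I_N}) \sum_(q in Col)
      (\prod_x sign_vector t 0 (p x) * \prod_x G (block_of x) (p x))
      *: (sgn q *: M q p).
  rewrite exchange_big /minor_power (det_power_col_stab _ hk); apply: eq_bigr => q _.
  under eq_bigr => x _ do rewrite mxE.
  rewrite bigA_distr_bigA mulr_sumr; apply: eq_bigr => p _.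
  rewrite big_split /= mulr_sign scaler_sign.
  have -> : \prod_x map_mx (@mpolyC (N * n) C) (G *m (diag_mx (sign_vector t))^T)
                      (block_of x) (p x)
    = (\prod_x sign_vector t 0 (p x) * \prod_x G (block_of x) (p x))%:MP.
    rewrite -big_split rmorph_prod /=; apply: eq_bigr => x _.
    by rewrite mxE tr_diag_mx mul_mx_diag mxE mulrC.
  by rewrite mul_mpolyC; case: (odd_perm q); rewrite ?scalerN.
rewrite /multilinear_part.
under eq_bigr => t _ do rewrite gl_act_minor_power det1 expr1n scale1r minorE.
transitivity (\sum_(p : {ffun 'I_N -> 'I_N} | injectiveb p)
   (\prod_x G (block_of x) (p x)) *: \sum_(q in Col) sgn q *: M q p).
  under eq_bigr => t _ do rewrite scaler_sumr.
  rewrite exchange_big scaler_sumr [RHS]big_mkcond; apply: eq_bigr => p _ /=.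
  have n2 : 2 ^+ N != 0 :> C by rewrite expf_neq0 ?pnatr_eq0.
  transitivity ((2 ^- N * \sum_t \prod_i (sign_vector t 0 i * sign_vector t 0 (p i)))
    *: ((\prod_x G (block_of x) (p x)) *: \sum_(q in Col) sgn q *: M q p)).
    rewrite -scalerA scaler_suml; congr (_ *: _); apply: eq_bigr => t _.
    by rewrite -scaler_sumr !scalerA big_split mulrA.
  rewrite sum_sign_vectors mulrA mulVf // mul1r.
  by case: ifP => _; rewrite ?scale1r ?scale0r.
rewrite (reindex (fun s : 'S_N => pval s)) /=; last first.
  pose in_S := insubd (1%g : 'S_N).
  by exists in_S => /= p inj_p; first apply: val_inj; apply: insubdK.
apply: eq_big => [s|s _]; first exact: (valP s).
rewrite act_polytabloidE /M; congr (_ *: _).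
  by apply: eq_bigr => x _; rewrite pvalE.
by apply: eq_bigr => q _; congr (_ *: _); apply: eq_bigr => x _; rewrite pvalE.
Qed.

Lemma multilinear_part_span G :
  group_span act e (multilinear_part (minor_power G)).
Proof. by rewrite multilinear_part_minor_power; eexists. Qed.

(** On the left of [X], this matrix sums the rows of each block. *)
Definition block_rows : 'M[C]_(n, N) := \matrix_(a, x) (block_of x == a)%:R.

Lemma multilinear_part_block_rows :
  multilinear_part (minor_power block_rows) = w'.
Proof.
rewrite multilinear_part_minor_power /spherical /row_sum [RHS]big_mkcond.
apply: eq_bigr => s _ /=.
have -> : \prod_x block_rows (block_of x) (s x) = (s \in Row)%:R.
  rewrite -(eval_block_monomial C hk) /eval_block sym_act_block_monomial.
  rewrite /eval_mx rmorph_prod; apply: eq_bigr => x _ /=.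
  by rewrite -/(eval_mx _ _) eval_Xmx !mxE.
by case: ifP => _; rewrite ?scale1r ?scale0r.
Qed.

Lemma wrdet_spherical : wrdet X = (k%:R ^- N : C) *: w'.
Proof.
have nk : k%:R != 0 :> C by rewrite pnatr_eq0 -lt0n.
have act_m0 := @block_monomial_fixed C k n hk.
rewrite -(alpha_sum_spherical hk (act := act) (@sym_actM C k n) act_m0).
rewrite /wrdet /detk; apply: eq_bigr => s _.
have -> : - k%:R^-1 = (- k%:R^-1 : C)%:MP :> {mpoly C[N * n]}.
  by rewrite rmorphN rmorphV ?unitfE // rmorph_nat.
rewrite -rmorphXn mul_mpolyC; congr (_ *: _).
rewrite /= sym_act_block_monomial; apply: eq_bigr => j _.
by rewrite mxE.
Qed.

End Multilinear.

(** * Highest weight vectors of weight a power of the determinant *)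

Lemma lup_decomposition (F : fieldType) m (h : 'M[F]_m) : (0 < m)%N ->
  exists (s : 'S_m) (L U : 'M[F]_m), [/\ h = perm_mx s *m L *m U,
    forall i j : 'I_m, (i < j)%N -> L i j = 0 &
    forall i j : 'I_m, (j < i)%N -> U i j = 0].
Proof.
case: m h => // m h _; have := cormen_lup_correct h.
have := cormen_lup_perm h; have := cormen_lup_lower h; have := cormen_lup_upper h.
case: cormen_lup => [[P L] U] /= upU lowL /is_perm_mxP[s ->] eqh.
exists s^-1%g, L, U; split=> // [|i j ij]; last first.
  by rewrite lowL ?(ltnW ij) //; case: eqP ij => // ->; rewrite ltnn.
have sV : perm_mx s^-1 *m perm_mx s = 1%:M :> 'M[F]_m.+1.
  by rewrite -perm_mxM mulVg perm_mx1.
by rewrite -mulmxA -[L *m U]eqh mulmxA sV mul1mx.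
Qed.

Section HighestWeight.
Variable C : numFieldType.

(** Multiplying by a power of t turns q(1/t) into a polynomial of degree at most
    that power, which forces p to be constant. *)
Lemma poly_inverse_const (p q : {poly C}) :
  (forall t, t != 0 -> p.[t] = q.[t^-1]) -> forall t, p.[t] = q.[0].
Proof.
move=> pq.
(* The reversed polynomial, t^(size q) q(1/t). *)
pose r := \sum_(i < size q) q`_i *: 'X^(size q - i).
have pr : p * 'X^(size q) = r.
  apply/eqP; rewrite -subr_eq0; apply/eqP/poly_eq0_of_eval => t nt.
  rewrite hornerD hornerN hornerM hornerXn pq // horner_coef mulr_suml /r horner_sum.
  apply/eqP; rewrite subr_eq0; apply/eqP; apply: eq_bigr => i _.
  rewrite hornerZ hornerXn -mulrA; congr (_ * _).
  by rewrite expfB_cond ?(negbTE nt) ?(ltnW (ltn_ord i)) // exprVn mulrC.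
have sr : (size r <= (size q).+1)%N.
  apply: (leq_trans (size_sum _ _ _)); apply/bigmax_leqP => i _.
  apply: (leq_trans (size_scale_leq _ _)).
  by rewrite size_polyXn ltnS leq_subr.
have sp : (size p <= 1)%N.
  case: (eqVneq p 0) => [->|np]; first by rewrite size_poly0.
  move: sr; rewrite -pr size_Mmonic ?monicXn // size_polyXn addnS /=.
  by rewrite -[(size q).+1]add1n leq_add2r.
have [c pc] : exists c, p = c%:P by exists p`_0; apply: size1_polyC.
suff -> : q = c%:P by move=> t; rewrite pc !hornerC.
apply/eqP; rewrite -subr_eq0; apply/eqP/poly_eq0_of_eval => t nt.
have ntV : t^-1 != 0 by rewrite invr_eq0.
by have := pq _ ntV; rewrite invrK pc hornerD hornerN !hornerC => ->; rewrite subrr.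
Qed.

Lemma eval_mx_path m (f : {mpoly C[m * m]}) (G : 'M[{poly C}]_m) :
  exists P : {poly C}, forall t, eval_mx f (map_mx (horner_eval t) G) = P.[t].
Proof.
exists (\sum_(a <- msupp f) f@_a *: \prod_i mxvec G 0 i ^+ a i) => t.
rewrite /eval_mx mevalE horner_sum; apply: eq_bigr => a _.
rewrite hornerZ horner_prod; congr (_ * _); apply: eq_bigr => i _.
by rewrite horner_exp -map_mxvec mxE.
Qed.

Variables (m k d : nat) (rho : 'M[C]_m -> 'M[C]_d) (v : 'cV[C]_d).
Hypothesis rho_poly : forall i j, exists p : {mpoly C[m * m]},
  forall g, g \in unitmx -> rho g i j = eval_mx p g.
Hypothesis rho1 : rho 1%:M = 1%:M.
Hypothesis rhoM : {in unitmx &, forall g h, rho (g *m h) = rho g *m rho h}.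
Hypothesis rho_upper : forall b, b \in unitmx -> is_trig_mx b^T ->
  rho b *m v = \det b ^+ k *: v.

Lemma rho_path (G : 'M[{poly C}]_m) i : exists P : {poly C}, forall t,
  map_mx (horner_eval t) G \in unitmx ->
  (rho (map_mx (horner_eval t) G) *m v) i 0 = P.[t].
Proof.
have ex j : exists P : {poly C}, forall t, map_mx (horner_eval t) G \in unitmx ->
    rho (map_mx (horner_eval t) G) i j = P.[t].
  have [p rhop] := rho_poly i j; have [P eP] := eval_mx_path p G.
  by exists P => t ut; rewrite rhop // eP.
have [Q eQ] := choice ex.
exists (\sum_j v j 0 *: Q j) => t ut; rewrite mxE horner_sum.
by apply: eq_bigr => j _; rewrite hornerZ mulrC eQ.
Qed.

Definition det_stable (g : 'M[C]_m) :=
  g \in unitmx /\ rho g *m v = \det g ^+ k *: v.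

Lemma det_stableM g h : det_stable g -> det_stable h -> det_stable (g *m h).
Proof.
move=> [ug eg] [uh eh]; split; first by rewrite unitmx_mul ug.
by rewrite rhoM // -mulmxA eh -scalemxAr eg scalerA det_mulmx mulrC exprMn.
Qed.

Lemma det_stable1 : det_stable 1%:M.
Proof. by split; rewrite ?unitmx1 // rho1 mul1mx det1 expr1n scale1r. Qed.

Lemma det_stable_upper b : b \in unitmx -> (forall i j : 'I_m, (j < i)%N -> b i j = 0) ->
  det_stable b.
Proof.
move=> ub upb; split=> //; apply: rho_upper => //; apply/is_trig_mxP => i j ij.
by rewrite mxE upb.
Qed.

(** Applied to v, the matrix [tperm_mx b a + s *: delta_mx b b] for s = 1/t is
    1 + t delta_(a,b) up to an upper triangular factor of determinant -1.  The
    result is polynomial both in t and in 1/t, hence constant; s = 0 gives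
    the transposition and t = 0 the identity. *)
Lemma det_stable_tperm (a b : 'I_m) : (b < a)%N -> det_stable (tperm_mx b a).
Proof.
move=> ba; have nba : (b == a) = false by apply: ltn_eqF.
have nab : (a == b) = false by rewrite eq_sym.
pose low (t : C) := 1%:M + t *: delta_mx a b : 'M[C]_m.
pose sw (s : C) := tperm_mx b a + s *: delta_mx b b : 'M[C]_m.
pose up (t : C) := \matrix_(i, j) (if i == b then if j == b then t^-1 else (j == a)%:R
   else if i == a then if j == a then - t else 0 else (i == j)%:R) : 'M[C]_m.
have det_low t : \det (low t) = 1.
  rewrite det_trig; last first.
    apply/is_trig_mxP => i j ij; rewrite !mxE.
    have -> : (i == j) = false by apply: ltn_eqF.
    case: eqP => [ia|_]; last by rewrite mulr0 addr0.
    case: eqP => [jb|_]; last by rewrite mulr0 addr0.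
    by rewrite -ia -jb ltnNge ltnW in ba.
  rewrite big1 // => i _; rewrite !mxE eqxx.
  case: eqP => [->|_]; last by rewrite mulr0 addr0.
  by rewrite nab mulr0 addr0.
have low_up t : t != 0 -> low t *m up t = sw t^-1.
  move=> nt; rewrite mulmxDl mul1mx -scalemxAl; apply/matrixP => i j.
  have dE : (delta_mx a b *m up t) i j = (i == a)%:R * up t b j.
    rewrite mxE (bigD1 b) //= big1 ?addr0 => [|l nl]; last first.
      by rewrite mxE (negbTE nl) andbF mul0r.
    by rewrite mxE eqxx andbT.
  rewrite [LHS]mxE [X in _ + X]mxE dE !mxE eqxx; case: (eqVneq i b) => [->|nib].
    rewrite tpermL nba mul0r mulr0 addr0 /=.
    by case: (eqVneq j b) => [->|_]; rewrite ?nab ?add0r ?mulr1 ?mulr0 ?addr0 // eq_sym.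
  rewrite /= mulr0 addr0; case: (eqVneq i a) => [->|nia].
    rewrite tpermR mul1r [b == j]eq_sym; case: (eqVneq j b) => [->|_].
      by rewrite nba add0r mulfV // mulr0 addr0.
    by case: (eqVneq j a) => _; rewrite ?mulr1 ?mulr0 ?addNr ?addr0.
  by rewrite mul0r mulr0 addr0 tpermD // eq_sym.
have up_upper t (i j : 'I_m) : (j < i)%N -> up t i j = 0.
  move=> ji; rewrite mxE; case: (eqVneq i b) => [ib|_].
    have jb : (j < b)%N by rewrite -ib.
    have -> : (j == b) = false by apply: ltn_eqF.
    by have -> : (j == a) = false by apply: ltn_eqF; apply: ltn_trans ba.
  case: (eqVneq i a) => [ia|_].
    by have -> : (j == a) = false by apply: ltn_eqF; rewrite -ia.
  by have -> : (i == j) = false by rewrite eq_sym; apply: ltn_eqF.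
have det_up t : t != 0 -> \det (up t) = -1.
  move=> nt; rewrite -det_tr det_trig; last first.
    by apply/is_trig_mxP => i j ij; rewrite mxE up_upper.
  rewrite (bigD1 b) //= (bigD1 a) ?nab //= big1 => [|i /andP[nib nia]].
    by rewrite !mxE !eqxx nab mulr1 mulrN mulVf.
  by rewrite !mxE (negbTE nib) (negbTE nia) eqxx.
have unit_low t : low t \in unitmx by rewrite unitmxE det_low unitr1.
have unit_tperm : tperm_mx b a \in @unitmx C m by apply: unitmx_perm.
have unit_sw s : sw s \in unitmx.
  case: (eqVneq s 0) => [->|ns]; first by rewrite /sw scale0r addr0.
  have nsV : s^-1 != 0 by rewrite invr_eq0.
  rewrite -[s]invrK -low_up // unitmxE det_mulmx det_low det_up //.
  by rewrite mul1r unitrN1.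
pose lowX := 1%:M + 'X *: delta_mx a b : 'M[{poly C}]_m.
pose swX := tperm_mx b a + 'X *: delta_mx b b : 'M[{poly C}]_m.
have lowE t : map_mx (horner_eval t) lowX = low t.
  by rewrite map_mxD map_mxZ map_delta_mx map_mx1 /= horner_evalE hornerX.
have swE t : map_mx (horner_eval t) swX = sw t.
  by rewrite map_mxD map_mxZ map_delta_mx map_perm_mx /= horner_evalE hornerX.
split=> //; rewrite det_perm odd_tperm eq_sym nab expr1; apply/colP => i.
have [P eP] := rho_path lowX i; have [Q eQ] := rho_path swX i.
have PQ t : t != 0 -> ((-1) ^+ k *: P).[t] = Q.[t^-1].
  move=> nt; rewrite hornerZ -eP lowE // -eQ swE // -low_up // rhoM //; last first.
    by rewrite unitmxE det_up // unitrN1.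
  have [] : det_stable (up t).
    by apply: det_stable_upper (up_upper t); rewrite unitmxE det_up // unitrN1.
  by move=> _ eup; rewrite -mulmxA eup det_up // -scalemxAr [RHS]mxE.
have := poly_inverse_const PQ 0; rewrite hornerZ -eP lowE // -eQ swE //.
by rewrite /low /sw !scale0r !addr0 rho1 mul1mx => <-; rewrite mxE.
Qed.

Hypothesis m_gt0 : (0 < m)%N.

Lemma det_stable_perm (s : 'S_m) : det_stable (perm_mx s).
Proof.
have [ts -> dts] := prod_tpermP s.
elim: ts dts => [|[x z] ts IH] /=.
  by rewrite big_nil perm_mx1 => _; apply: det_stable1.
move=> /andP[nxz /IH Hts]; rewrite big_cons perm_mxM /=; apply: det_stableM => //.
have := nxz; rewrite /dpair /= neq_ltn => /orP[xz|zx]; first exact: det_stable_tperm.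
by rewrite tpermC; apply: det_stable_tperm.
Qed.

(** By LUP decomposition it is enough to treat permutations and triangular
    matrices, and the reversal of the indices exchanges lower and upper ones. *)
Lemma det_stable_unit h : h \in unitmx -> det_stable h.
Proof.
have lower L : L \in unitmx -> (forall i j : 'I_m, (i < j)%N -> L i j = 0) ->
    det_stable L.
  move=> uL lowL; pose r := perm (@rev_ord_inj m).
  have rK : (r * r = 1)%g by apply/permP => i; rewrite permM !permE rev_ordK.
  have WW : perm_mx r *m perm_mx r = 1%:M :> 'M[C]_m by rewrite -perm_mxM rK perm_mx1.
  have -> : L = perm_mx r *m (perm_mx r *m L *m perm_mx r) *m perm_mx r.
    by rewrite !mulmxA WW mul1mx -mulmxA WW mulmx1.
  apply/det_stableM/det_stable_perm; apply: (det_stableM (det_stable_perm _)).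
  apply: det_stable_upper; first by rewrite !unitmx_mul unitmx_perm uL.
  have rV : r = (r^-1)%g by apply: (mulgI r); rewrite rK mulgV.
  move=> i j ji; rewrite {2}rV -col_permE -row_permE !mxE !permE lowL //=.
  by apply: ltn_sub2l => //; apply: leq_trans (ltn_ord i).
move=> uh; have [s [L [U [hE lowL upU]]]] := lup_decomposition h m_gt0.
have : perm_mx s *m L *m U \in unitmx by rewrite -hE.
rewrite !unitmx_mul => /andP[/andP[_ uL] uU]; rewrite hE.
apply: det_stableM; last exact: det_stable_upper.
by apply: (det_stableM (det_stable_perm s)); apply: lower.
Qed.

End HighestWeight.

(** * The irreducible component of weight (k^n) *)

(** A matrix with invertible top block [A1] is a unipotent lower triangular
    matrix times [pid_mx n] times [A1], so the hypotheses determine [f] on it up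
    to the value at [pid_mx n]; such matrices are dense. *)
Lemma semi_invariant_minor_power (C : numFieldType) N n k (f : {mpoly C[N * n]}) :
  (n <= N)%N ->
  (forall h, h \in unitmx -> gl_act (1%:M, h) f = \det h ^+ k *: f) ->
  (forall b, b \in unitmx -> is_trig_mx b^T -> (forall i, b i i = 1) ->
     gl_act (b, 1%:M) f = f) ->
  f = eval_mx f (pid_mx n) *:
        \det (map_mx (@mpolyC (N * n) C) (pid_mx n) *m Xmx C N n) ^+ k.
Proof.
move=> le_nN inv_h inv_b; set D := \det _; set c := eval_mx _ _.
have evD A : eval_mx D A = \det (pid_mx n *m A).
  rewrite /eval_mx -det_map_mx map_mxM; congr (\det (_ *m _)).
    by apply/matrixP => i j; rewrite !mxE /= mevalC.
  by apply/matrixP => i j; rewrite mxE /= XmxE mevalXU mxvecE.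
have nzD : D != 0.
  apply: contra_eq_neq (evD (pid_mx n)) => ->.
  rewrite /eval_mx rmorph0 mul_pid_mx minnn (minn_idPr le_nN) pid_mx_1 det1.
  by rewrite eq_sym oner_eq0.
(* The factor [D] takes care of the points with a singular top block. *)
suff : (f - c *: D ^+ k) * D = 0.
  by move/eqP; rewrite mulf_eq0 (negbTE nzD) orbF subr_eq0 => /eqP.
apply: eval_mx_inj => A.
have -> : eval_mx ((f - c *: D ^+ k) * D) A
  = (eval_mx f A - c * eval_mx D A ^+ k) * eval_mx D A.
  by rewrite /eval_mx rmorphM rmorphB /= mevalZ rmorphXn.
have -> : eval_mx (0 : {mpoly C[N * n]}) A = 0 by rewrite /eval_mx rmorph0.
rewrite evD; set A1 := pid_mx n *m A.
case: (eqVneq (\det A1) 0) => [->|nzA1]; first by rewrite mulr0.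
have uA1 : A1 \in unitmx by rewrite unitmxE unitfE.
suff -> : eval_mx f A = c * \det A1 ^+ k by rewrite subrr mul0r.
have [b [ub tb b1 AE]] : exists b : 'M[C]_N, [/\ b \in unitmx, is_trig_mx b^T,
    forall i, b i i = 1 & A = b^T *m pid_mx n *m A1].
  rewrite /A1 in uA1 *; clear -le_nN uA1.
  have [m eN] : exists m, N = (n + m)%N by exists (N - n)%N; rewrite subnKC.
  subst N; set A1 := pid_mx n *m A in uA1 *.
  exists (block_mx 1%:M 0 (dsubmx A *m invmx A1) 1%:M)^T; split.
  - by rewrite unitmx_tr unitmxE det_lblock !det1 mulr1 unitr1.
  - by rewrite trmxK is_trig_block_mx // eqxx !scalar_mx_is_trig.
  - move=> i; rewrite mxE; case: (split_ordP i) => j ->.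
      by rewrite block_mxEul mxE eqxx.
    by rewrite block_mxEdr mxE eqxx.
  - rewrite trmxK pid_mx_col mul_block_col !mulmx0 !addr0 !mulmx1.
    rewrite mul_col_mx mul1mx -mulmxA mulVmx // mulmx1.
    have -> : A1 = usubmx A.
      by rewrite /A1 pid_mx_row -{1}[A]vsubmxK mul_row_col mul1mx mul0mx addr0.
    by rewrite vsubmxK.
have := inv_h _ uA1 => /(congr1 (fun f => eval_mx (gl_act (b, 1%:M) f) (pid_mx n))).
rewrite linearZ /= inv_b // gl_actM /= mulmx1 mul1mx eval_gl_act /= -AE => ->.
by rewrite /eval_mx mevalZ mulrC.
Qed.

Section Component.
Variables (C : numClosedFieldType) (k n : nat) (hk : (0 < k)%N).
Local Notation N := (k * n)%N.
Local Notation X := (Xmx C N n).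
Local Notation act := (@sym_action C k n).
Local Notation e := (polytabloid act (block_monomial C k n)).
Local Notation w' := (spherical act (block_monomial C k n)).
Local Notation S := (group_span act e).

Lemma minor_powerMl (B : 'M[C]_n) (G : 'M[C]_(n, N)) :
  minor_power (B *m G) = \det B ^+ k *: minor_power G.
Proof.
rewrite /minor_power map_mxM -mulmxA det_mulmx det_map_mx exprMn.
by rewrite -rmorphXn /= mul_mpolyC.
Qed.

Lemma minor_power_singular (G : 'M[C]_(n, N)) : (\rank G < n)%N -> minor_power G = 0.
Proof.
move=> rG; rewrite /minor_power; suff -> : \det (map_mx (@mpolyC (N * n) C) G *m X) = 0.
  by rewrite expr0n gtn_eqF.
apply/eqP/det0P.
have [v nzv vG] : exists2 v : 'rV[C]_n, v != 0 & v *m G = 0.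
  have /rowV0Pn[v vG nv] : kermx G != 0.
    by rewrite -mxrank_eq0 mxrank_ker -lt0n subn_gt0.
  by exists v => //; apply/eqP; rewrite -sub_kermx.
exists (map_mx (@mpolyC (N * n) C) v); last by rewrite mulmxA -map_mxM vG map_mx0 mul0mx.
apply: contra nzv => /eqP/matrixP v0; apply/eqP/matrixP => i j.
by have := v0 i j; rewrite !mxE => /eqP; rewrite mpolyC_eq0 => /eqP.
Qed.

Variable M : {mpoly C[N * n]} -> Prop.
Hypothesis subM : is_submodule (@GLxGL C N n) (@gl_act C N n) M.
Hypothesis M_top : M (minor_power (pid_mx n)).

(** A matrix of rank n is [pid_mx n] up to invertible factors on both sides, the
    right one being absorbed by the group action. *)
Lemma component_minor_power G : M (minor_power G).
Proof.
have [rG|rG] := ltnP (\rank G) n; first by rewrite minor_power_singular //; case: subM.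
have {}rG : \rank G = n by apply/eqP; rewrite eqn_leq rank_leq_row.
rewrite -(mulmx_ebase G) rG -mulmxA minor_powerMl; apply: (submoduleZ subM).
have := gl_act_minor_power ((row_ebase G)^T, 1%:M) (pid_mx n).
rewrite /= det1 expr1n scale1r trmxK => <-; apply: (submodule_act subM) => //.
by split; rewrite /= ?unitmx_tr ?row_ebase_unit ?unitmx1.
Qed.

Lemma component_spherical : M w'.
Proof.
rewrite -(multilinear_part_block_rows C n hk) /multilinear_part.
apply/(submoduleZ subM)/(submodule_sum subM) => t _.
apply/(submoduleZ subM)/(submodule_act subM); last exact: component_minor_power.
by split; [exact: sign_vector_unit | exact: unitmx1].
Qed.

Lemma span_component f : S f -> M f.
Proof.
move=> /(polytabloid_span_spherical hk (@sym_act1 C k n) (@sym_actM C k n)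
  (@block_monomial_fixed C k n hk) (eval_block_monomial C hk)).
apply: group_span_min; last exact: component_spherical.
case: (subM) => M0 Mlin Mact; split=> // g u _; apply: Mact.
by split; [exact: permutation_matrix_unit | exact: unitmx1].
Qed.

End Component.

Section Span.
Variables (C : numClosedFieldType) (k n : nat) (hk : (0 < k)%N).
Local Notation N := (k * n)%N.
Local Notation X := (Xmx C N n).
Local Notation act := (@sym_action C k n).
Local Notation e := (polytabloid act (block_monomial C k n)).
Local Notation w' := (spherical act (block_monomial C k n)).
Local Notation S := (group_span act e).

Lemma span_torus_weight f (t : 'rV[C]_N) : S f ->
  gl_act (diag_mx t, 1%:M) f = \det (diag_mx t) *: f.
Proof.
rewrite det_diag; set T := gl_act _; set d := \prod_i t 0 i.
have t_mono (s q : 'S_N) : T (\prod_x X (s x) (block_of (q x)))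
    = d *: \prod_x X (s x) (block_of (q x)) :> {mpoly C[N * n]}.
  have -> : d = \prod_x t 0 (s x) by rewrite /d (reindex_inj (@perm_inj _ s)).
  rewrite /T rmorph_prod -mul_mpolyC rmorph_prod.
  rewrite -big_split; apply: eq_bigr => x _ /=.
  rewrite gl_act_Xmx /gl_point /= map_mx1 mulmx1.
  by rewrite tr_diag_mx map_diag_mx mul_diag_mx !mxE.
have t_e s : T (act s e) = d *: act s e.
  rewrite (act_polytabloidE C hk) /T gl_act_sum scaler_sumr; apply: eq_bigr => q _.
  by rewrite gl_actZ -/T t_mono !scalerA mulrC.
move=> [z ->]; rewrite /T gl_act_sum scaler_sumr; apply: eq_bigr => s _.
by rewrite gl_actZ -/T t_e !scalerA mulrC.
Qed.

Lemma multilinear_part_id (f : {mpoly C[N * n]}) :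
  (forall t, diag_mx t \in unitmx ->
     gl_act (diag_mx t, 1%:M) f = \det (diag_mx t) *: f) ->
  multilinear_part f = f.
Proof.
move=> tf; rewrite /multilinear_part (eq_bigr (fun=> f)) => [|t _].
  rewrite sumr_const card_ffun card_bool card_ord -scaler_nat natrX scalerA.
  by rewrite mulVf ?scale1r // expf_neq0 ?pnatr_eq0.
rewrite tf ?sign_vector_unit // scalerA det_diag -big_split big1 ?scale1r // => i _.
by rewrite /= mxE -signr_addb addbb.
Qed.

Lemma detk_map (R1 R2 : comUnitRingType) (f : {rmorphism R1 -> R2}) l m (B : 'M[R1]_m) :
  l%:R \is a @GRing.unit R1 -> f (detk l B) = detk l (map_mx f B).
Proof.
move=> ul; rewrite rmorph_sum; apply: eq_bigr => s _.
rewrite rmorphM rmorphXn rmorphN rmorphV // rmorph_nat rmorph_prod; congr (_ * _).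
by apply: eq_bigr => j _; rewrite mxE.
Qed.

Lemma eval_wrdet A : eval_mx (wrdet X) A = wrdet A.
Proof.
have nk : k%:R != 0 :> C by rewrite pnatr_eq0 -lt0n.
rewrite /eval_mx /wrdet detk_map; last first.
  by rewrite -(rmorph_nat (@mpolyC (N * n) C)) rmorph_unit // unitfE.
by congr detk; apply/matrixP => i j; rewrite !mxE /= mevalXU mxvecE.
Qed.

Lemma block_ones_repeat : block_ones C k n = col_repeat k (block_point C k n).
Proof. by apply/matrixP => i j; rewrite !mxE. Qed.

Lemma phi_eval g : phi C g = eval_block (act g^-1 w') / eval_block w'.
Proof.
have nk : k%:R ^- N != 0 :> C by rewrite invr_eq0 expf_neq0 // pnatr_eq0 -lt0n.
have E f : eval_block (act g^-1 f) = eval_mx f (row_act g (block_point C k n)).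
  rewrite /eval_block /sym_action /= /sym_act eval_gl_act /= mulmx1.
  congr (eval_mx f _).
  by rewrite permutation_matrixE trmxK -row_permE; apply/matrixP => i j; rewrite !mxE.
have -> : phi C g = eval_mx (wrdet X) (row_act g (block_point C k n))
                    / eval_block (wrdet X).
  rewrite /phi /eval_block !eval_wrdet block_ones_repeat; congr (detk _ _ / _).
  by apply/matrixP => i j; rewrite !mxE.
by rewrite -!E (wrdet_spherical C n hk) !linearZ /= -mulf_div divff // mul1r.
Qed.

Lemma phi_conj (g : 'S_N) : (phi C g)^* = phi C g.
Proof.
have uk : k%:R \is a @GRing.unit C by rewrite unitfE pnatr_eq0 -lt0n.
have real B : map_mx Num.conj B = B -> (detk k B)^* = detk k B :> C.
  by move=> rB; rewrite [LHS](detk_map Num.conj B uk) rB.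
by rewrite /phi fmorph_div /= !real //; apply/matrixP => i j;
  rewrite !mxE rmorph_nat.
Qed.

(** Evaluation at the block point gives the quotient of inner products at
    [g^-1]; hermitian symmetry undoes the inverse at the cost of a conjugation,
    which fixes the real number [phi C g]. *)
Lemma phi_inner_product ip : invariant_inner_product act S ip ->
  forall g, phi C g = ip (act g w') w' / ip w' w'.
Proof.
move=> ipP g; have act1 := @sym_act1 C k n; have actM := @sym_actM C k n.
have m0P := @block_monomial_fixed C k n hk; have E0 := eval_block_monomial C hk.
have sub := group_span_submodule actM e.
have Sw := spherical_span_polytabloid act1 actM (block_monomial C k n).
have Sg s : S (act s w') by apply: (submodule_act sub).
rewrite -phi_conj phi_eval -(inner_product_spherical hk act1 actM (E0 n) ipP).
rewrite fmorph_div /=; congr (_ / _); last by rewrite -(inner_productC ipP Sw Sw).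
rewrite -(inner_productC ipP (Sg _) Sw) -(inner_product_act ipP g Sw (Sg _)).
by rewrite (act_invKV act1 actM).
Qed.

Lemma phi_wrdet ip : invariant_inner_product act S ip ->
  forall g, phi C g = ip (act g (wrdet X)) (wrdet X) / ip (wrdet X) (wrdet X).
Proof.
move=> ipP g; rewrite (phi_inner_product ipP) (wrdet_spherical C n hk) linearZ.
have sub := group_span_submodule (@sym_actM C k n) e.
have Sw : S w' by apply: spherical_span_polytabloid; [exact: sym_act1|exact: sym_actM].
have Sg : S (act g w') by apply: (submodule_act sub).
rewrite !(inner_productZZ sub ipP) // -mulf_div divff ?mul1r //.
by rewrite mul_conjC_eq0 invr_eq0 expf_neq0 // pnatr_eq0 -lt0n.
Qed.

Lemma phi_positive_definite : positive_definite (@phi C k n).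
Proof.
have act1 := @sym_act1 C k n; have actM := @sym_actM C k n.
have m0P := @block_monomial_fixed C k n hk; have E0 := eval_block_monomial C hk.
have ipP := tabloid_form_inner_product hk act1 actM m0P (E0 n).
move=> c; under eq_bigr => g _ do under eq_bigr => h _ do
  rewrite (phi_inner_product ipP).
exact: (spherical_positive_definite act1 actM).
Qed.

End Span.

(** The whole group, and not only its Borel subgroup, acts on the highest weight
    vector through a character; its line is then stable, so it is everything. *)
Lemma det_power_rep_line (C : numFieldType) m k d (rho : 'M[C]_m -> 'M[C]_d) :
  (0 < m)%N -> irr_poly_rep (nseq m k) rho ->
  exists v : 'cV[C]_d, [/\ v != 0,
    forall h, h \in unitmx -> rho h *m v = \det h ^+ k *: v &
    forall u, exists c, u = c *: v].
Proof.
move=> m_gt0 [rho_poly rho1 rhoM [_ _ irr] [v nzv hw]].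
have detv h : h \in unitmx -> rho h *m v = \det h ^+ k *: v.
  move=> uh; suff [] : det_stable k rho v h by [].
  apply: det_stable_unit => // b ub tb; rewrite hw // -[\det b]det_tr det_trig //.
  rewrite -prodrXl; congr (_ *: _); apply: eq_bigr => i _.
  by rewrite nth_nseq ltn_ord mxE.
exists v; split=> // u.
have [|//|v0|line] := irr (fun u => exists c, u = c *: v).
- split=> [|a _ _ [c1 ->] [c2 ->]|h _ uh [c ->]].
  + by exists 0; rewrite scale0r.
  + by exists (a * c1 + c2); rewrite scalerDl scalerA.
  + by exists (c * \det h ^+ k); rewrite -scalemxAr detv // scalerA.
- by case/eqP: nzv; apply: v0; exists 1; rewrite scale1r.
- exact: line.
Qed.

Section Generator.
Variables (C : numClosedFieldType) (k n : nat) (hk : (0 < k)%N) (hn : (0 < n)%N).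
Local Notation N := (k * n)%N.

(** The image of the tensor product of the highest weight vectors is proportional
    to the power of the top minor; the second factor being a line,
    irreducibility of the first one makes it a generator. *)
Lemma component_generator (M : {mpoly C[N * n]} -> Prop) :
  is_irr_component (nseq n k) M ->
  [/\ is_submodule (@GLxGL C N n) (@gl_act C N n) M,
      M (minor_power (pid_mx n)) &
      forall Q : {mpoly C[N * n]} -> Prop,
        is_submodule (@GLxGL C N n) (@gl_act C N n) Q ->
        Q (minor_power (pid_mx n)) -> forall f, M f -> Q f].
Proof.
move=> [d1 [d2 [rho1 [rho2 [irr1 irr2 [Phi [Phi_inj Phi_im Phi_act]]]]]]].
have [v2 [nzv2 det2 line2]] := det_power_rep_line hn irr2.
have [_ rho1_1 _ [_ _ irr1'] [v1 nzv1 hw1]] := irr1.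
have [_ rho2_1 _ _ _] := irr2.
have subM : is_submodule (@GLxGL C N n) (@gl_act C N n) M.
  split=> [|a f g /Phi_im[Y _ ->] /Phi_im[Z _ ->]|gh f ugh /Phi_im[Y _ ->]]; apply/Phi_im.
  - by exists 0; rewrite ?linear0.
  - by exists (a *: Y + Z); rewrite ?linearP.
  - by exists (rho1 gh.1 *m Y *m (rho2 gh.2)^T); rewrite ?Phi_act.
pose f0 := Phi (v1 *m v2^T).
have nzf0 : f0 != 0.
  apply/eqP => /(Phi_inj _ I)/matrixP v0.
  have /matrix0Pn[i [j nzi]] := nzv1; have /matrix0Pn[l [o nzl]] := nzv2.
  have := v0 i l; rewrite mxE big_ord1 !mxE => /eqP; rewrite mulf_eq0.
  by move: nzi nzl; rewrite !ord1 => /negbTE-> /negbTE->.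
have le_nN : (n <= N)%N by rewrite leq_pmull.
have f0E : f0 = eval_mx f0 (pid_mx n) *: minor_power (pid_mx n).
  apply: semi_invariant_minor_power => // [h uh|b ub tb b1].
    rewrite -Phi_act //; last by split; rewrite ?unitmx1.
    rewrite rho1_1 mul1mx -mulmxA -trmx_mul det2 //.
    by rewrite linearZ /= -scalemxAr linearZ.
  rewrite -Phi_act //; last by split; rewrite ?unitmx1.
  rewrite rho2_1 trmx1 mulmx1 mulmxA hw1 // big1 ?scale1r // => i _.
  by rewrite b1 expr1n.
have nzc : eval_mx f0 (pid_mx n) != 0.
  by apply: contra_neq nzf0 => c0; rewrite f0E c0 scale0r.
have topE : minor_power (pid_mx n) = (eval_mx f0 (pid_mx n))^-1 *: f0.
  by rewrite [X in _ *: X]f0E scalerA mulVf // scale1r.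
split=> // [|Q subQ Qtop f /Phi_im[Y _ ->]].
  by rewrite topE; apply: (submoduleZ subM); apply/Phi_im; exists (v1 *m v2^T).
have Q1 u : Q (Phi (u *m v2^T)).
  have [|//|v0|] := irr1' (fun u => Q (Phi (u *m v2^T))); last by apply.
  - have [Q0 Qlin Qact] := subQ; split=> [|a x z Qx Qz|g x ug Qx].
    + by rewrite mul0mx linear0.
    + by rewrite mulmxDl -scalemxAl linearP; apply: Qlin.
    + have ugh : GLxGL (g, 1%:M : 'M[C]_n) by split; rewrite //= unitmx1.
      have := Qact (g, 1%:M) _ ugh Qx; rewrite -Phi_act //.
      by rewrite rho2_1 trmx1 mulmx1 mulmxA.
  - case/eqP: nzv1; apply: v0; rewrite -/f0 f0E.
    exact: (submoduleZ subQ).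
have -> : Y = \sum_i delta_mx i 0 *m row i Y.
  apply/matrixP => i j; rewrite summxE (bigD1 i) //= big1 => [|l nl].
    by rewrite mxE big_ord1 !mxE !eqxx mul1r addr0.
  by rewrite mxE big_ord1 !mxE eq_sym (negbTE nl) mul0r.
rewrite linear_sum; apply: (submodule_sum subQ) => i _ /=.
have [c Ec] := line2 (row i Y)^T.
rewrite -[row i Y]trmxK Ec linearZ /= -scalemxAr linearZ.
exact: (submoduleZ subQ).
Qed.

Local Notation act := (@sym_action C k n).
Local Notation e := (polytabloid act (block_monomial C k n)).
Local Notation w' := (spherical act (block_monomial C k n)).
Local Notation S := (group_span act e).

(** That the multilinear part of every GL-translate lies in S is a property
    stable under GL, so it extends from the power of the top minor to the whole
    component; and an element of weight det is its own multilinear part. *)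
Lemma torus_det_component (M : {mpoly C[N * n]} -> Prop) :
  is_irr_component (nseq n k) M -> torus_det M = S.
Proof.
move=> compM; have [subM Mtop Mgen] := component_generator compM.
have subS := group_span_submodule (@sym_actM C k n) e.
apply/funext => f; apply/propext; split=> [[Mf tf]|Sf]; last first.
  split; first exact: (span_component hk subM Mtop).
  by move=> t _; apply: span_torus_weight.
rewrite -(multilinear_part_id tf) -[f]gl_act1.
pose Q f := forall gh, GLxGL gh -> S (multilinear_part (gl_act gh f)).
have Qtop : Q (minor_power (pid_mx n)).
  move=> gh _; rewrite gl_act_minor_power multilinear_partZ.
  by apply: (submoduleZ subS); apply: (multilinear_part_span hk).
have subQ : is_submodule (@GLxGL C N n) (@gl_act C N n) Q.
  split=> [gh _|a g h Qg Qh gh ugh|gh g ugh Qg gh' ugh'].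
  - rewrite (linear0 (gl_act gh)) linear0; by case: subS.
  - rewrite (linearP (gl_act gh)) linearP; have [_ Slin _] := subS.
    by apply: Slin; [apply: Qg|apply: Qh].
  - rewrite gl_actM; apply: Qg; case: ugh ugh' => u1 u2 [u1' u2'].
    by split; rewrite /= unitmx_mul ?u1 ?u2 ?u1' ?u2'.
by apply: (Mgen Q subQ Qtop f Mf); split; apply: unitmx1.
Qed.

End Generator.

Theorem lemma7p5 (R : realType) (k n : nat) (hk : (0 < k)%N) (hn : (0 < n)%N) :
  (forall M : {mpoly R[i][(k * n) * n]} -> Prop,
     is_irr_component (nseq n k) M ->
     let V := torus_det M in
     let act := @sym_act R[i] (k * n) n in
     let w := wrdet (Xmx R[i] (k * n) n) in
     [/\ V w,
         is_irreducible (fun=> True) act V,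
         isomorphic (fun=> True)
           (@left_transl R[i] (k * n)) (@specht R[i] (k * n) (nseq n k)) act V,
         exists ip, invariant_inner_product act V ip &
         forall ip, invariant_inner_product act V ip ->
           forall g : 'S_(k * n), phi R[i] g = ip (act g w) w / ip w w])
  /\ positive_definite (@phi R[i] k n).
Proof.
split; last exact: phi_positive_definite.
move=> M compM V act w.
have act1 := @sym_act1 R[i] k n; have actM := @sym_actM R[i] k n.
have m0P := @block_monomial_fixed R[i] k n hk; have E0 := eval_block_monomial R[i] hk.
have -> : V = group_span (@sym_action R[i] k n)
    (polytabloid (@sym_action R[i] k n) (block_monomial R[i] k n)).
  exact: torus_det_component.
have sub := group_span_submodule actM
  (polytabloid (@sym_action R[i] k n) (block_monomial R[i] k n)).
have Sw := spherical_span_polytabloid act1 actM (block_monomial R[i] k n).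
have wE : w = _ := wrdet_spherical R[i] n hk.
split.
- by rewrite wE; apply: (submoduleZ sub).
- exact: (span_irreducible hk act1 actM m0P (E0 n)).
- exact: (specht_isomorphic hk act1 actM m0P (E0 n)).
- by eexists; apply: (tabloid_form_inner_product hk act1 actM m0P (E0 n)).
by move=> ip ipP; apply: phi_wrdet.
Qed.
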